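(* Let $G$ be a Garside group with positive monoid $G^+\neq\{1\}$, Garside element $\Delta$ and set $\mathcal D$ of simple elements. There is an algorithm that, given elements $g,h\in G$ (as words over the finite alphabet $\mathcal D\cup\mathcal D^{-1}$), halts after finitely many steps and correctly decides whether or not $h\in[g]^{\mathrm{St}}$, where $[g]^{\mathrm{St}}$ is the stable super summit set of $g$.
   Context: Garside groups. Let $M$ be a monoid. An atom is an element $a\in M\setminus\{1\}$ such that $a=bc$ implies $b=1$ or $c=1$. For $a\in M$, $\|a\|$ is the supremum of the lengths of all expressions of $a$ as a product of atoms. $M$ is atomic if it is generated by its atoms and $\|a\|<\infty$ for all $a\in M$. In an atomic monoid, $a\le_L b$ means $ac=b$ for some $c\in M$, and $a\le_R b$ means $ca=b$ for some $c\in M$; these are partial orders. An atomic monoid $M$ is a Garside monoid if (i) $M$ is finitely generated; (ii) $M$ is left and right cancellative; (iii) $(M,\le_L)$ and $(M,\le_R)$ are lattices; (iv) there is an element $\Delta\in M$ (a Garside element) such that for each $a\in M$, $a\le_L\Delta$ if and only if $a\le_R\Delta$, and the set $\{a\in M: a\le_L\Delta\}$ generates $M$. The set of simple elements is $\mathcal D=\{a\in M: a\le_L\Delta\}$ (a finite set). A Garside monoid embeds in its group of fractions $G$, which is called a Garside group; $M$ is identified with its image in $G$, denoted $G^+$ and called the positive monoid. For $g,h\in G$, $g\le_L h$ means $gc=h$ for some $c\in G^+$. Invariants. For $g\in G$, $\inf(g)=\max\{r\in\mathbb Z:\Delta^r\le_L g\}$ and $\sup(g)=\min\{s\in\mathbb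 Z: g\le_L\Delta^s\}$. Let $[g]=\{h^{-1}gh: h\in G\}$ be the conjugacy class, $\inf_s(g)=\max\{\inf(h):h\in[g]\}$ and $\sup_s(g)=\min\{\sup(h):h\in[g]\}$. The super summit set is $[g]^S=\{h\in[g]:\inf(h)=\inf_s(g),\ \sup(h)=\sup_s(g)\}$ (finite and nonempty). The stable super summit set is $[g]^{\mathrm{St}}=\{h\in[g]^S: h^n\in[g^n]^S\text{ for all }n\ge1\}$. *)

(* Defs.v *)
From Stdlib Require Import Classical.
From mathcomp Require Import all_boot all_order ssralg ssrnum ssrint.

Set Implicit Arguments.
Unset Strict Implicit.
Unset Printing Implicit Defensive.

Local Open Scope group_scope.

Section GarsideMonoid.
Variable M : monoidType.
Implicit Types (a b c : M) (s : seq M) (S : M -> Prop).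

Definition mprod s : M := \prod_(x <- s) x.

Definition generates S : Prop :=
  forall a, exists2 s, (forall x, x \in s -> S x) & mprod s = a.

Definition atom a : Prop :=
  a <> 1 /\ forall b c, a = b * c -> b = 1 \/ c = 1.

(* The supremum of the lengths of the expressions of [a] as a product of
   atoms is finite iff these lengths are bounded by a natural number. *)
Definition norm_finite a : Prop :=
  exists N : nat, forall s, (forall x, x \in s -> atom x) -> mprod s = a ->
    (size s <= N)%N.

Definition atomic : Prop := generates atom /\ forall a, norm_finite a.

Definition leL a b : Prop := exists c, a * c = b.
Definition leR a b : Prop := exists c, c * a = b.

Definition finitely_generated : Prop :=
  exists s, generates (fun x => x \in s).

Definition cancellative : Prop :=
  (forall a b c, a * b = a * c -> b = c) /\
  (forall a b c, b * a = c * a -> b = c).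

Definition is_meet (le : M -> M -> Prop) a b m : Prop :=
  [/\ le m a, le m b & forall c, le c a -> le c b -> le c m].
Definition is_join (le : M -> M -> Prop) a b j : Prop :=
  [/\ le a j, le b j & forall c, le a c -> le b c -> le j c].
Definition has_meets_joins (le : M -> M -> Prop) : Prop :=
  forall a b, (exists m, is_meet le a b m) /\ (exists j, is_join le a b j).

Definition garside_element Delta : Prop :=
  (forall a, leL a Delta <-> leR a Delta) /\
  generates (fun a => leL a Delta).

(* In an atomic monoid [leL] and [leR] are automatically partial orders, so
   having binary meets and joins amounts to being a lattice. *)
Definition garside_monoid : Prop :=
  [/\ atomic, finitely_generated, cancellative,
      has_meets_joins leL /\ has_meets_joins leR
    & exists Delta, garside_element Delta].

Definition enumerates_simples Delta (n : nat) (d : 'I_n -> M) : Prop :=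
  injective d /\ forall a, leL a Delta <-> exists i, d i = a.

Lemma mprod_nil : mprod [::] = 1.
Proof. by rewrite /mprod big_nil. Qed.

Lemma mprod_cons x s : mprod (x :: s) = x * mprod s.
Proof. by rewrite /mprod big_cons. Qed.

Lemma mprod_cat s1 s2 : mprod (s1 ++ s2) = mprod s1 * mprod s2.
Proof. by rewrite /mprod big_cat. Qed.

Lemma atom_in_generators s a :
  generates (fun x => x \in s) -> atom a -> a \in s.
Proof.
move=> /(_ a) [t ts <-] {a}.
elim: t ts => [|x t IH] ts [neq1 irr]; first by rewrite mprod_nil in neq1.
have ts' y : y \in t -> y \in s by move=> yt; apply: ts; rewrite in_cons yt orbT.
rewrite mprod_cons in neq1 irr *.
have [x1|t1] := irr x (mprod t) erefl; last first.
  by rewrite t1 mulg1; apply: ts; rewrite mem_head.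
by rewrite x1 mul1g in neq1 irr *; apply: IH.
Qed.

Lemma list_filter (P : M -> Prop) s :
  exists s', forall a, a \in s' <-> a \in s /\ P a.
Proof.
elim: s => [|x s [s' IH]]; first by exists [::] => a; rewrite in_nil; split=> // -[].
have [Px|nPx] := classic (P x); [exists (x :: s') => a | exists s' => a].
- rewrite !in_cons; case: eqP => [->|_] /=; last exact: IH.
  by split.
- rewrite in_cons IH; case: eqP => [->|_] //=.
  by split=> -[].
Qed.

Lemma bounded_products s N : exists P : seq M, forall t,
  {subset t <= s} -> (size t <= N)%N -> mprod t \in P.
Proof.
elim: N => [|N [P IH]].
  by exists [:: 1] => -[|//] _ _; rewrite mprod_nil mem_head.
exists (1 :: [seq x * p | x <- s, p <- P]) => -[|x t] ts ltN.
  by rewrite mprod_nil mem_head.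
rewrite in_cons mprod_cons; apply/orP; right.
apply/allpairsP; exists (x, mprod t); split=> //=.
  by apply: ts; rewrite mem_head.
by apply: IH => // y yt; apply: ts; rewrite in_cons yt orbT.
Qed.

Lemma simples_finite Delta :
  garside_monoid -> exists n (d : 'I_n -> M), enumerates_simples Delta d.
Proof.
move=> [[gen_atom normf] [s gen_s] _ _ _].
have [N leN] := normf Delta.
have [P inP] := bounded_products s N.
have [s' s'P] := list_filter (fun a => leL a Delta) P.
have s'E a : a \in undup s' <-> leL a Delta.
  rewrite mem_undup s'P; split=> [[]//|lea]; split=> //.
  have [c ac] := lea.
  have [t at_ ta] := gen_atom a; have [t' at' tc] := gen_atom c.
  rewrite -ta; apply: inP.
    by move=> x /at_; apply: atom_in_generators.
  have : (size (t ++ t') <= N)%N.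
    apply: leN => [x|]; last by rewrite mprod_cat ta tc.
    by rewrite mem_cat => /orP[/at_|/at'].
  by rewrite size_cat; apply: leq_trans; apply: leq_addr.
exists (size (undup s')), (tnth (in_tuple (undup s'))); split.
  by apply/tuple_uniqP; apply: undup_uniq.
move=> a; rewrite -s'E; split=> [/(tnthP (in_tuple _)) [i ->]|[i <-]].
  by exists i.
exact: mem_tnth.
Qed.

End GarsideMonoid.

Arguments generates {M} S.
Arguments garside_monoid M : clear implicits.

(* [iota] presents [G] as the group of fractions of [M]; the image of [iota]
   is the positive monoid.  When [M] is a Garside monoid these conditions
   determine [G] and [iota] up to isomorphism. *)
Definition group_of_fractions (M : monoidType) (G : groupType)
    (iota : M -> G) : Prop :=
  [/\ monoid_morphism iota, injective iota
    & forall g, exists a b, g = iota a * (iota b)^-1].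

Definition is_max (P : int -> Prop) (r : int) : Prop :=
  P r /\ forall q, P q -> (q <= r)%R.
Definition is_min (P : int -> Prop) (r : int) : Prop :=
  P r /\ forall q, P q -> (r <= q)%R.

Definition zpow (G : groupType) (g : G) (r : int) : G :=
  match r with Posz n => g ^+ n | Negz n => g ^- n.+1 end.

Section GarsideGroup.
Variables (M : monoidType) (G : groupType) (iota : M -> G) (Delta : M).
Implicit Types g h : G.

Definition gleL g h : Prop := exists c : M, g * iota c = h.

Definition is_inf g (r : int) : Prop :=
  is_max (fun q => gleL (zpow (iota Delta) q) g) r.
Definition is_sup g (r : int) : Prop :=
  is_min (fun q => gleL g (zpow (iota Delta) q)) r.

(* [g ^ x] is [x^-1 * g * x]. *)
Definition conjugate g h : Prop := exists x, h = g ^ x.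

Definition is_inf_s g (r : int) : Prop :=
  is_max (fun q => exists2 h, conjugate g h & is_inf h q) r.
Definition is_sup_s g (r : int) : Prop :=
  is_min (fun q => exists2 h, conjugate g h & is_sup h q) r.

Definition super_summit g h : Prop :=
  [/\ conjugate g h,
      exists2 r, is_inf h r & is_inf_s g r
    & exists2 r, is_sup h r & is_sup_s g r].

Definition stable_super_summit g h : Prop :=
  super_summit g h /\
  forall n : nat, (1 <= n)%N -> super_summit (g ^+ n) (h ^+ n).

End GarsideGroup.

(* Words over the simple elements [d i], written [(i, false)], and their
   formal inverses, written [(i, true)]. *)
Definition word (n : nat) := seq ('I_n * bool).

Definition word_value (M : monoidType) (G : groupType) (iota : M -> G)
    (n : nat) (d : 'I_n -> M) (w : word n) : G :=
  \prod_(l <- w) (if l.2 then (iota (d l.1))^-1 else iota (d l.1)).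

Definition word_code (n : nat) (w : word n) : nat :=
  CodeSeq.code [seq (nat_of_ord l.1).*2 + nat_of_bool l.2 | l : 'I_n * bool <- w]%N.

(* Kleene's mu-recursive functions: [partrec k] is the type of programs with
   [k] inputs.  The finite family of functions substituted by [Comp] is indexed
   by an ordinal type. *)
Inductive partrec : nat -> Type :=
| Zero k : partrec k
| Succ : partrec 1
| Proj k (i : 'I_k) : partrec k
| Comp m k (f : partrec m) (gs : 'I_m -> partrec k) : partrec k
| Prec k (f : partrec k) (g : partrec k.+2) : partrec k.+1
| Mu k (f : partrec k.+1) : partrec k.

Section PrecGraph.
Variables (k : nat) (F : k.-tuple nat -> nat -> Prop)
  (H : k.+2.-tuple nat -> nat -> Prop) (v : k.-tuple nat).
Fixpoint prec_graph (y : nat) (z : nat) : Prop :=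
  if y is y'.+1 then
    exists2 z', prec_graph y' z' & H [tuple of y' :: z' :: v] z
  else F v z.
End PrecGraph.

(* [evaluates f v y]: the program [f] halts on the input [v] with output [y]. *)
Fixpoint evaluates k (f : partrec k) : k.-tuple nat -> nat -> Prop :=
  match f in partrec k return k.-tuple nat -> nat -> Prop with
  | Zero k => fun _ y => y = 0%N
  | Succ => fun v y => y = (thead v).+1
  | Proj k i => fun v y => y = tnth v i
  | Comp m k f gs => fun v y =>
      exists2 w : m.-tuple nat, forall j, evaluates (gs j) v (tnth w j)
        & evaluates f w y
  | Prec k f g => fun v y =>
      prec_graph (evaluates f) (evaluates g) [tuple of behead v] (thead v) y
  | Mu k f => fun v y =>
      evaluates f [tuple of y :: v] 0%N /\
      forall x, (x < y)%N -> exists z, evaluates f [tuple of x :: v] z.+1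
  end.

Lemma evaluates_functional k (f : partrec k) v y z :
  evaluates f v y -> evaluates f v z -> y = z.
Proof.
elim: f v y z => {k} [k|| k i| m k f IHf gs IHg| k f IHf g IHg| k f IHf] v y z /=.
- by move=> -> ->.
- by move=> -> ->.
- by move=> -> ->.
- move=> [w gw fw] [w' gw' fw'].
  have e : w = w' by apply: eq_from_tnth => j; apply: IHg (gw j) (gw' j).
  by rewrite -e in fw'; apply: IHf fw fw'.
- elim: (thead v) y z => [|n IHn] y z /=; first exact: IHf.
  move=> [y' ry gy] [z' rz gz]; have e := IHn _ _ ry rz.
  by rewrite -e in gz; apply: IHg gy gz.
- move=> [y0 ylt] [z0 zlt]; case: (ltngtP y z) => // [/zlt|/ylt] [x ex].
    by have := IHf _ _ _ y0 ex.
  by have := IHf _ _ _ z0 ex.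
Qed.

(* Main.v *)
From Stdlib Require Import Classical ClassicalEpsilon.
Require Import Defs.
From mathcomp Require Import all_boot all_order ssralg ssrnum ssrint intdiv zify.

Set Implicit Arguments.
Unset Strict Implicit.
Unset Printing Implicit Defensive.

Import CodeSeq.

(* Write D for Delta and <= for the left order.  The condition that some
   conjugate of g^n has infimum at least r, i.e. x D^r <= g^n x for some x, only
   depends on the slope r/n, and passing to joins of the translates g^-k x D^s
   shows that an attained slope whose denominator exceeds the number of simple
   elements is exceeded by an attained slope of smaller denominator.  So the
   greatest attained slope is A/m with m fixed, and h^n has the greatest infimum
   in its class for all n >= 1 as soon as it does for n <= m.  Suprema are infima
   of inverses.

   It remains to decide finitely many questions of the form: is there an x with
   g x = x h, resp. x D^r <= Q x.  Some power E of D is central, and by convexity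
   x can be taken to be a product of simple elements of E along a simple path in
   the finite set of the elements lying between E^-l and E^l; in the second case
   this uses that the least x >= 1 with x D^r <= Q x does not increase the
   supremum.  Finally, divisibility of positive words is decided by computing
   residuals letter by letter with a finite table. *)

(** * Recursive functions *)

(** Stability quantifies over all n, and conjugacy and maximality of infima quantify over the
    infinite group; each quantifier has to become finite with a computable bound. For n the obstacle
    is that a slope p/q is attained only by a power of g. [staircase] works around it with elements
    that behave like fractional powers x D^(i/q), on which g acts as if its own infimum were p/q.
    The resulting bound on denominators depends on M alone, so m can be a factorial that serves
    every h. Right multiplication by a general element need not respect the left order. This is why
    the central power E is needed: it clears inverses out of words, makes conjugators positive, and
    gives a finite alphabet closed under residuals. Classical choice selects e, m, the alphabets and
    the residual table. For fixed M and D these are finite data hard-wired into the program, so they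
    do not affect its computability. *)

Definition computable k (F : seq nat -> nat) : Prop :=
  exists p : partrec k, forall v : k.-tuple nat, evaluates p v (F v).

Definition computable1 (f : nat -> nat) :=
  computable 1 (fun v => f (nth 0 v 0)).
Definition computable2 (f : nat -> nat -> nat) :=
  computable 2 (fun v => f (nth 0 v 0) (nth 0 v 1)).

(** * Closure under composition, change of variables and primitive recursion *)

Lemma eq_computable k F F' :
  (forall v, size v = k -> F v = F' v) -> computable k F -> computable k F'.
Proof.
by move=> eqF [p pF]; exists p => v; rewrite -eqF ?size_tuple.
Qed.

Lemma computable_nth k i : i < k -> computable k (fun v => nth 0 v i).
Proof.
move=> ltik; exists (Proj (Ordinal ltik)) => v /=.
by rewrite (tnth_nth 0).
Qed.

Lemma computable_comp k F (Gs : seq (seq nat -> nat)) :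
  computable (size Gs) F ->
  (forall j, j < size Gs -> computable k (nth (fun=> 0) Gs j)) ->
  computable k (fun v => F [seq A v | A <- Gs]).
Proof.
move=> [p pF] cG.
have /fin_all_exists[gs gsP] (j : 'I_(size Gs)) : exists q : partrec k,
    forall v : k.-tuple nat, evaluates q v (nth (fun=> 0) Gs j v).
  exact: cG.
exists (Comp p gs) => v /=.
exists (map_tuple (fun A : seq nat -> nat => A v) (in_tuple Gs)) => [j|].
  by rewrite tnth_map (tnth_nth (fun=> 0)); apply: gsP.
exact: pF.
Qed.

Lemma computable_comp1 k f A :
  computable1 f -> computable k A -> computable k (fun v => f (A v)).
Proof.
by move=> cf cA; apply: (@computable_comp k _ [:: A] cf); case.
Qed.

Lemma computable_comp2 k f A B :
  computable2 f -> computable k A -> computable k B ->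
  computable k (fun v => f (A v) (B v)).
Proof.
by move=> cf cA cB; apply: (@computable_comp k _ [:: A; B] cf); case=> [|[|]].
Qed.

Lemma computable_const k c : computable k (fun=> c).
Proof.
elim: c => [|c IH]; first by exists (Zero k).
apply: (@computable_comp1 k succn _ _ IH).
by exists Succ => v /=; rewrite /thead (tnth_nth 0).
Qed.

Lemma computable_succ k A : computable k A -> computable k (fun v => (A v).+1).
Proof.
apply: computable_comp1.
by exists Succ => v /=; rewrite /thead (tnth_nth 0).
Qed.

Lemma computable_rename m k F (s : seq nat) :
  size s = m -> all (fun i => i < k) s -> computable m F ->
  computable k (fun w => F [seq nth 0 w i | i <- s]).
Proof.
move=> szs alls cF.
have sz : size [seq (fun w => nth 0 w i) | i <- s] = m by rewrite size_map.
apply: eq_computable (@computable_comp k F [seq (fun w => nth 0 w i) | i <- s]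
  _ _) => [v _||j].
- by rewrite -map_comp.
- by rewrite sz.
rewrite size_map => ltj; rewrite (nth_map 0) //.
by apply: computable_nth; apply: (allP alls); apply: mem_nth.
Qed.

Lemma computable_drop i k F :
  computable k F -> computable (i + k) (fun w => F (drop i w)).
Proof.
move=> cF; apply: eq_computable
  (@computable_rename k (i + k) F (iota i k) _ _ cF) => [v szv||].
- congr F; apply: (@eq_from_nth _ 0) => [|j].
    by rewrite size_map size_iota size_drop szv addKn.
  rewrite size_map size_iota => ltj.
  by rewrite (nth_map 0) ?size_iota // nth_iota // nth_drop.
- by rewrite size_iota.
- by apply/allP => j; rewrite mem_iota => /andP[].
Qed.

(** For predicates used inside a recursion: the variables between the bound variable and the
    parameters (previous value, outer counter) are discarded. *)
Lemma computable_skip i k F :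
  computable k.+1 F ->
  computable (i.+1 + k) (fun w => F (nth 0 w 0 :: drop i.+1 w)).
Proof.
move=> cF; apply: eq_computable
  (@computable_rename k.+1 (i.+1 + k) F (0 :: iota i.+1 k) _ _ cF) => [v szv||].
- congr (F (_ :: _)); apply: (@eq_from_nth _ 0) => [|j].
    by rewrite size_map size_iota size_drop szv addKn.
  rewrite size_map size_iota => ltj.
  by rewrite (nth_map 0) ?size_iota // nth_iota // nth_drop.
- by rewrite /= size_iota.
- by apply/allP => j; rewrite inE mem_iota => /orP[/eqP ->|/andP[]].
Qed.

Lemma computable_rec k b s t :
  computable k b -> computable k.+2 s -> computable k t ->
  computable k (fun v =>
    nat_rect (fun=> nat) (b v) (fun y z => s [:: y, z & v]) (t v)).
Proof.
move=> [pb bP] [ps sP] ct.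
pose F w := nat_rect (fun=> nat) (b (behead w))
  (fun y z => s [:: y, z & behead w]) (nth 0 w 0).
have cF : computable k.+1 F.
  exists (Prec pb ps) => v /=.
  rewrite /F.
  have -> : nth 0 v 0 = thead v by rewrite /thead (tnth_nth 0).
  elim: (thead v) => [|y IH] /=; first exact: (bP [tuple of behead v]).
  by exists (nat_rect (fun=> nat) (b (behead v))
    (fun y z => s [:: y, z & behead v]) y) => //;
    apply: (sP [tuple of y :: _ :: behead v]).
pose Gs := t :: [seq (fun w => nth 0 w i) | i <- iota 0 k].
apply: eq_computable (@computable_comp k F Gs _ _) => [v szv||].
- have vE : [seq A v | A <- Gs] = t v :: v.
    rewrite /Gs map_cons -map_comp; congr (_ :: _); apply: (@eq_from_nth _ 0).
      by rewrite size_map size_iota.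
    move=> j; rewrite size_map size_iota => ltj.
    by rewrite (nth_map 0) ?size_iota // nth_iota.
  by rewrite vE.
- by rewrite /= size_map size_iota.
- case=> // j; rewrite /= size_map size_iota ltnS => ltj.
  by rewrite (nth_map 0) ?size_iota // nth_iota //; apply: computable_nth.
Qed.

Lemma computable_iter k b s t :
  computable k b -> computable k.+1 s -> computable k t ->
  computable k (fun v => iter (t v) (fun z => s (z :: v)) (b v)).
Proof.
move=> cb cs ct.
have := computable_rec cb (@computable_drop 1 _ _ cs) ct.
apply: eq_computable => v _ /=.
by elim: (t v) => //= y ->; rewrite drop0.
Qed.

(** * Arithmetic and Boolean operations *)

Lemma computable_add : computable2 addn.
Proof.
have c1 : computable 2 (fun v => nth 0 v 1) by apply: computable_nth.
have c0 : computable 2 (fun v => nth 0 v 0) by apply: computable_nth.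
have cs : computable 3 (fun w => (nth 0 w 0).+1).
  by apply: computable_succ; apply: computable_nth.
apply: eq_computable (computable_iter c1 cs c0) => v _ /=.
by elim: (nth 0 v 0) => //= n ->.
Qed.

Lemma computable_mul : computable2 muln.
Proof.
have cs : computable 3 (fun w => nth 0 w 2 + nth 0 w 0).
  by apply: (computable_comp2 computable_add); apply: computable_nth.
apply: eq_computable (computable_iter (computable_const _ 0) cs
  (@computable_nth 2 0 isT)) => v _ /=.
by elim: (nth 0 v 0) => //= n ->; rewrite mulSn.
Qed.

Lemma computable_exp : computable2 expn.
Proof.
have cs : computable 3 (fun w => nth 0 w 1 * nth 0 w 0).
  by apply: (computable_comp2 computable_mul); apply: computable_nth.
apply: eq_computable (computable_iter (computable_const _ 1) cs
  (@computable_nth 2 1 isT)) => v _ /=.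
by elim: (nth 0 v 1) => //= n ->; rewrite expnS.
Qed.

Lemma computable_pred : computable1 predn.
Proof.
apply: eq_computable (computable_rec (computable_const 1 0)
  (@computable_nth 3 0 isT) (@computable_nth 1 0 isT)) => v _ /=.
by case: (nth 0 v 0).
Qed.

Lemma computable_sub : computable2 subn.
Proof.
have cs : computable 3 (fun w => (nth 0 w 0).-1).
  by apply: (computable_comp1 computable_pred); apply: computable_nth.
apply: eq_computable (computable_iter (@computable_nth 2 0 isT) cs
  (@computable_nth 2 1 isT)) => v _ /=.
by elim: (nth 0 v 1) => /= [|n ->]; rewrite ?subn0 // subnS.
Qed.

Lemma computable_if k (c : seq nat -> bool) A B :
  computable k c -> computable k A -> computable k B ->
  computable k (fun v => if c v then A v else B v).
Proof.
move=> cc cA cB.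
apply: eq_computable (computable_comp2 computable_add
  (computable_comp2 computable_mul cc cA)
  (computable_comp2 computable_mul
    (computable_comp2 computable_sub (computable_const k 1) cc) cB)) => v _ /=.
by case: (c v); rewrite ?mul1n ?mul0n ?addn0 ?add0n.
Qed.

Lemma computable_not k (c : seq nat -> bool) :
  computable k c -> computable k (fun v => ~~ c v).
Proof.
move=> cc; apply: eq_computable (computable_if cc (computable_const k 0)
  (computable_const k 1)) => v _.
by case: (c v).
Qed.

Lemma computable_and k (c d : seq nat -> bool) :
  computable k c -> computable k d -> computable k (fun v => c v && d v).
Proof.
move=> cc cd; apply: eq_computable (computable_if cc cd (computable_const k 0)).
by move=> v _; case: (c v).
Qed.

Lemma computable_or k (c d : seq nat -> bool) :
  computable k c -> computable k d -> computable k (fun v => c v || d v).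
Proof.
move=> cc cd; apply: eq_computable (computable_if cc (computable_const k 1) cd).
by move=> v _; case: (c v).
Qed.

Lemma computable_leq k A B :
  computable k A -> computable k B -> computable k (fun v => A v <= B v).
Proof.
move=> cA cB; apply: eq_computable (computable_comp2 computable_sub
  (computable_const k 1) (computable_comp2 computable_sub cA cB)) => v _.
by rewrite -subn_eq0; case: (A v - B v).
Qed.

Lemma computable_eq k A B :
  computable k A -> computable k B -> computable k (fun v => A v == B v).
Proof.
move=> cA cB; apply: eq_computable
  (computable_and (computable_leq cA cB) (computable_leq cB cA)) => v _.
by rewrite eqn_leq.
Qed.

(** * Bounded search *)

Lemma computable_has k b (c : seq nat -> bool) :
  computable k b -> computable k.+1 c ->
  computable k (fun v => has (fun x => c (x :: v)) (iota 0 (b v))).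
Proof.
move=> cb cc.
have cs : computable k.+2 (fun w => c (nth 0 w 0 :: drop 2 w) || (nth 0 w 1 != 0)).
  apply: computable_or; first exact: (@computable_skip 1 k _ cc).
  by apply: computable_not; apply: computable_eq;
    [apply: computable_nth | apply: computable_const].
apply: eq_computable (computable_rec (computable_const k 0) cs cb) => v szv.
set P := fun x => c (x :: v).
suff eqP n : nat_rect (fun=> nat) 0 (fun y z => P y || (z != 0)) n
    = has P (iota 0 n) by rewrite -eqP /= drop0.
elim: n => // n IH; rewrite -[LHS]/(nat_of_bool (_ || (nat_rect _ _ _ n != 0))).
by rewrite IH -[in RHS]addn1 iotaD has_cat /= orbF orbC; case: has.
Qed.

Lemma computable_find k b (c : seq nat -> bool) :
  computable k b -> computable k.+1 c ->
  computable k (fun v => find (fun x => c (x :: v)) (iota 0 (b v))).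
Proof.
move=> cb cc.
(* [find] counts the bounds [n] below which no witness has occurred *)
have cs : computable k.+2 (fun w => nth 0 w 1 +
    ~~ has (fun x => c (x :: drop 2 w)) (iota 0 (nth 0 w 0).+1)).
  apply: (computable_comp2 computable_add); first exact: computable_nth.
  apply: computable_not.
  apply: (@computable_has k.+2 (fun w => (nth 0 w 0).+1)
    (fun w => c (nth 0 w 0 :: drop 3 w))).
    by apply: computable_succ; apply: computable_nth.
  exact: (@computable_skip 2 k _ cc).
apply: eq_computable (computable_rec (computable_const k 0) cs cb) => v szv.
set P := fun x => c (x :: v).
suff eqP n : nat_rect (fun=> nat) 0 (fun y z => z + ~~ has P (iota 0 y.+1)) n
    = find P (iota 0 n) by rewrite -eqP /= drop0.
elim: n => // n IH; rewrite -[LHS]/(nat_rect (fun=> nat) _ _ n + _) IH.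
rewrite -addn1 iotaD has_cat find_cat add0n /= orbF.
have [hasP|/hasNfind ->] := boolP (has P (iota 0 n)); first by rewrite addn0.
by rewrite size_iota; case: (P n).
Qed.

Lemma find_iota_unique P n a :
  a < n -> (forall x, P x = (x == a)) -> find P (iota 0 n) = a.
Proof.
move=> ltan PE.
have hasP : has P (iota 0 n).
  by apply/hasP; exists a; rewrite ?mem_iota ?PE.
have := nth_find 0 hasP; rewrite has_find size_iota in hasP.
by rewrite nth_iota // add0n PE => /eqP.
Qed.

(** * Coding of lists by numbers *)

Lemma code_pair_inj a b a' b' :
  2 ^ a * b.*2.+1 = 2 ^ a' * b'.*2.+1 -> a = a' /\ b = b'.
Proof.
move=> e; have : code (a :: decode b) = code (a' :: decode b').
  by rewrite /= -!/(code _) !decodeK.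
by move/(can_inj codeK) => [-> /(can_inj decodeK)].
Qed.

(** Makes decoding a bounded search: head and tail are found below the code itself. *)
Lemma code_cons_gt a s : a < code (a :: s) /\ code s < code (a :: s).
Proof.
rewrite /= -/(code s); split.
  by apply: leq_trans (@ltn_expl 2 a isT) _; rewrite leq_pmulr.
apply: leq_ltn_trans (_ : (code s).*2 < _); first by rewrite -addnn leq_addr.
by rewrite leq_pmull // expn_gt0.
Qed.

Lemma computable_pair k A B :
  computable k A -> computable k B ->
  computable k (fun v => 2 ^ A v * (B v).*2.+1).
Proof.
move=> cA cB; apply: (computable_comp2 computable_mul).
  by apply: (computable_comp2 computable_exp) => //; apply: computable_const.
apply: computable_succ.
apply: eq_computable (computable_comp2 computable_add cB cB) => v _.
exact: addnn.
Qed.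

Lemma computable_head : computable1 (fun c => head 0 (decode c)).
Proof.
have cP : computable 3 (fun v =>
    2 ^ nth 0 v 1 * (nth 0 v 0).*2.+1 == nth 0 v 2).
  by apply: computable_eq; first apply: computable_pair; apply: computable_nth.
have cH := @computable_has 2 _ _ (@computable_nth 2 1 isT) cP.
apply: eq_computable (computable_find (@computable_nth 1 0 isT) cH) => v _ /=.
move: (nth 0 v 0) => c; rewrite -[c]decodeK codeK.
(* The empty list has code 0, so the search range is empty and [find] returns 0, which is the
   default of [head]. *)
case: (decode c) => [//|a s]; have [lta lts] := code_cons_gt a s.
apply: find_iota_unique => // x; apply/idP/eqP => [|->].
  by case/hasP=> b _ /eqP/code_pair_inj[].
by apply/hasP; exists (code s); rewrite ?mem_iota /=.
Qed.

Lemma computable_behead : computable1 (fun c => code (behead (decode c))).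
Proof.
have cP : computable 2 (fun v =>
    2 ^ head 0 (decode (nth 0 v 1)) * (nth 0 v 0).*2.+1 == nth 0 v 1).
  apply: computable_eq; last exact: computable_nth.
  apply: computable_pair; last exact: computable_nth.
  by apply: (computable_comp1 computable_head); apply: computable_nth.
apply: eq_computable (computable_find (@computable_nth 1 0 isT) cP) => v _ /=.
move: (nth 0 v 0) => c; rewrite -[c]decodeK codeK.
case: (decode c) => [//|a s]; have [lta lts] := code_cons_gt a s.
apply: find_iota_unique => // x; apply/eqP/eqP => [|->] //.
by case/code_pair_inj.
Qed.

Lemma size_decode c : size (decode c) <= c.
Proof.
rewrite -{2}[c]decodeK; elim: (decode c) => // a s IH.
exact: leq_ltn_trans IH (code_cons_gt a s).2.
Qed.

Lemma computable_foldl k S A0 B :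
  computable k.+2 S -> computable k A0 -> computable k (fun v => code (B v)) ->
  computable k (fun v => foldl (fun acc x => S [:: acc, x & v]) (A0 v) (B v)).
Proof.
move=> cS cA cB.
(* the loop state is the code of [acc :: rest] *)
pose St (w : seq nat) := let: st := nth 0 w 0 in
  let: r := code (behead (decode st)) in
  if r == 0 then st
  else code (S [:: head 0 (decode st), head 0 (decode r) & drop 1 w]
             :: behead (decode r)).
have c0 : computable k.+1 (fun w => nth 0 w 0) by apply: computable_nth.
have cr := computable_comp1 computable_behead c0.
have cSt : computable k.+1 St.
  apply: computable_if => //.
    by apply: computable_eq => //; apply: computable_const.
  apply: computable_pair; last exact: (computable_comp1 computable_behead cr).
  pose Gs := [:: (fun w => head 0 (decode (nth 0 w 0))),
    (fun w => head 0 (decode (code (behead (decode (nth 0 w 0)))))) &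
    [seq (fun w => nth 0 w i) | i <- iota 1 k]].
  have szG : size Gs = k.+2 by rewrite /= size_map size_iota.
  rewrite -szG in cS.
  apply: eq_computable (computable_comp cS _) => [v szv|j].
    rewrite /Gs !map_cons -map_comp.
    congr (S [:: _, _ & _]); apply: (@eq_from_nth _ 0) => [|j].
      by rewrite size_map size_iota size_drop szv subn1.
    rewrite size_map size_iota => ltj.
    by rewrite (nth_map 0) ?size_iota // nth_iota // nth_drop.
  rewrite szG; case: j => [|[|j]] ltj.
  - exact: (computable_comp1 computable_head).
  - exact: (computable_comp1 computable_head cr).
  - rewrite /Gs /= (nth_map 0) ?size_iota // nth_iota //.
    exact: computable_nth.
(* The number of rounds is the code of the list, which bounds its length; rounds after the list is
   exhausted leave the state unchanged. *)
have ci := computable_iter (computable_pair cA cB) cSt cB.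
apply: eq_computable (computable_comp1 computable_head ci) => v szv /=.
rewrite -[2 ^ A0 v * _]/(code (A0 v :: B v)).
pose f acc x := S [:: acc, x & v].
suff itE n : forall a s, size s <= n ->
    iter n (fun z => St (z :: v)) (code (a :: s)) = code [:: foldl f a s].
  rewrite itE ?codeK //; have := size_decode (code (B v)).
  by rewrite codeK.
elim: n => [|n IH] a s; first by rewrite leqn0 size_eq0 => /eqP ->.
have codeE b r : St (code (b :: r) :: v) =
    if r is x :: r' then code (f b x :: r') else code [:: b].
  rewrite /St -[nth _ _ _]/(code (b :: r)) codeK [behead _]/= codeK.
  case: r => [|x r'] //; case: eqP => [/(can_inj codeK (x2 := [::]))//|_].
  by rewrite [drop 1 _]/= drop0.
rewrite iterSr codeE; case: s => [_|x s /IH ->] //.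
by rewrite (IH a [::]).
Qed.

(** * List-valued functions, computed through codes *)

Definition lcomputable k (A : seq nat -> seq nat) : Prop :=
  computable k (fun v => code (A v)).

Lemma lcomputable_decode k A :
  computable k A -> lcomputable k (fun v => decode (A v)).
Proof. by apply: eq_computable => v _; rewrite decodeK. Qed.

Lemma lcomputable_cons k A B :
  computable k A -> lcomputable k B -> lcomputable k (fun v => A v :: B v).
Proof. exact: computable_pair. Qed.

Lemma lcomputable_behead k A :
  lcomputable k A -> lcomputable k (fun v => behead (A v)).
Proof.
move=> cA; apply: eq_computable (computable_comp1 computable_behead cA) => v _.
by rewrite codeK.
Qed.

Lemma computable_lhead k A :
  lcomputable k A -> computable k (fun v => head 0 (A v)).
Proof.
move=> cA; apply: eq_computable (computable_comp1 computable_head cA) => v _.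
by rewrite codeK.
Qed.

Lemma lcomputable_foldl k (S : seq nat -> nat -> seq nat) A0 B :
  lcomputable 2 (fun v => S (decode (nth 0 v 0)) (nth 0 v 1)) ->
  lcomputable k A0 -> lcomputable k B ->
  lcomputable k (fun v => foldl S (A0 v) (B v)).
Proof.
move=> cS cA cB.
have cS2 : computable2 (fun c x => code (S (decode c) x)) by [].
have cS' : computable k.+2 (fun w => code (S (decode (nth 0 w 0)) (nth 0 w 1))).
  by apply: (computable_comp2 cS2); apply: computable_nth.
apply: eq_computable (computable_foldl cS' cA cB) => v _ /=.
by elim: (B v) (A0 v) => //= x s IH a; rewrite codeK.
Qed.

Lemma lcomputable_rev k A : lcomputable k A -> lcomputable k (fun v => rev (A v)).
Proof.
move=> cA.
have cc : lcomputable 2 (fun v => nth 0 v 1 :: decode (nth 0 v 0)).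
  apply: lcomputable_cons; first exact: computable_nth.
  by apply: lcomputable_decode; apply: computable_nth.
apply: eq_computable
  (lcomputable_foldl (S := fun acc x => x :: acc) cc
    (computable_const k (code [::])) cA) => v _.
by rewrite /rev; congr code; elim: (A v) [::] => //= x s IH t.
Qed.

Lemma lcomputable_cat k A B :
  lcomputable k A -> lcomputable k B -> lcomputable k (fun v => A v ++ B v).
Proof.
move=> cA cB.
have cc : lcomputable 2 (fun v => nth 0 v 1 :: decode (nth 0 v 0)).
  apply: lcomputable_cons; first exact: computable_nth.
  by apply: lcomputable_decode; apply: computable_nth.
apply: eq_computable (lcomputable_foldl (S := fun acc x => x :: acc) cc cB
  (lcomputable_rev cA)) => v _.
by rewrite foldl_rev; congr code; elim: (A v) => //= x s ->.
Qed.

Lemma lcomputable_map k f A :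
  computable1 f -> lcomputable k A -> lcomputable k (fun v => map f (A v)).
Proof.
move=> cf cA.
have cc : lcomputable 2 (fun v => f (nth 0 v 1) :: decode (nth 0 v 0)).
  apply: lcomputable_cons.
    by apply: (computable_comp1 cf); apply: computable_nth.
  by apply: lcomputable_decode; apply: computable_nth.
apply: eq_computable (lcomputable_foldl (S := fun acc x => f x :: acc) cc
  (computable_const k (code [::])) (lcomputable_rev cA)) => v _.
by rewrite foldl_rev; congr code; elim: (A v) => //= x s ->.
Qed.

Lemma computable_size k A :
  lcomputable k A -> computable k (fun v => size (A v)).
Proof.
move=> cA.
have cs : computable k.+2 (fun w => (nth 0 w 0).+1).
  by apply: computable_succ; apply: computable_nth.
apply: eq_computable (computable_foldl cs (computable_const k 0) cA) => v _ /=.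
by rewrite -[size _]addn0; elim: (A v) 0 => //= x s IH a; rewrite IH addnS.
Qed.

Lemma computable_all k (P : pred nat) A :
  computable1 P -> lcomputable k A -> computable k (fun v => all P (A v)).
Proof.
move=> cP cA.
have cs : computable k.+2 (fun w => (nth 0 w 0 != 0) && P (nth 0 w 1)).
  apply: computable_and.
    by apply: computable_not; apply: computable_eq;
      [apply: computable_nth | apply: computable_const].
  by apply: (computable_comp1 cP); apply: computable_nth.
apply: eq_computable (computable_foldl cs (computable_const k 1) cA) => v _ /=.
rewrite -[all _ _]andTb -[1]/(nat_of_bool true).
elim: (A v) true => [|x s IH] b /=; first by rewrite andbT.
by rewrite eqb0 negbK IH andbA.
Qed.

(** * Finite tables and the size of codes *)

(** Truncation leaves finitely many values, so a cascade of comparisons computes [T] even when it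
    comes from classical choice. *)
Lemma computable_table1 N (T : nat -> nat) : computable1 (fun x => T (minn x N)).
Proof.
elim: N => [|N IH].
  by apply: eq_computable (computable_const 1 (T 0)) => v _; rewrite minn0.
have cle : computable 1 (fun v => nth 0 v 0 <= N).
  by apply: computable_leq; [apply: computable_nth | apply: computable_const].
apply: eq_computable (computable_if cle IH (computable_const 1 (T N.+1))) => v _.
by case: leqP => [/leqW/minn_idPl ->|/minn_idPr ->].
Qed.

Lemma computable_table2 N (T : nat -> nat -> nat) :
  computable2 (fun x y => T (minn x N) (minn y N)).
Proof.
rewrite /computable2; elim: {2}N => [|m IH].
  have c0 : computable 2 (fun v => nth 0 v 0) by apply: computable_nth.
  apply: eq_computable
    (computable_comp1 (computable_table1 N (fun x => T x 0)) c0) => v _.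
  by rewrite minn0.
have cle : computable 2 (fun v => nth 0 v 1 <= m).
  by apply: computable_leq; [apply: computable_nth | apply: computable_const].
have cT : computable 2 (fun v => T (minn (nth 0 v 0) N) m.+1).
  apply: (computable_comp1 (computable_table1 N (T^~ m.+1))).
  exact: computable_nth.
apply: eq_computable (computable_if cle IH cT) => v _.
by case: leqP => [/leqW/minn_idPl ->|/minn_idPr ->].
Qed.

(** Prepending an entry a <= N multiplies [(code s).+1] by at most 2 ^ N.+1. *)
Lemma code_lt_bound N s :
  all (fun j => j <= N) s -> code s < 2 ^ (N.+1 * size s).
Proof.
elim: s => [|a s IH] /= ; first by rewrite expn_gt0.
rewrite -/(code s) => /andP[leaN /IH lts].
rewrite [N.+1 * _]mulnS expnD.
have ltd : (code s).*2.+1 < (code s).+1.*2 by rewrite doubleS.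
apply: (@leq_trans (2 ^ a * (code s).+1.*2)).
  by rewrite ltn_pmul2l ?expn_gt0.
by rewrite -mul2n mulnA -expnSr leq_mul // leq_exp2l.
Qed.

(** * Garside groups *)

Local Open Scope group_scope.

(** * Integer powers *)

Section IntegerPowers.
Variable G : groupType.
Implicit Types (g h : G) (r s : int).

Lemma zpow_nat g (k : nat) : zpow g k = g ^+ k.
Proof. by []. Qed.

Lemma zpowS g r : zpow g (r + 1)%R = zpow g r * g.
Proof.
case: r => [k|[|k]].
- by rewrite -PoszD addn1 zpow_nat expgSr.
- by rewrite /= expg1 mulVg.
- have -> : (Negz k.+1 + 1 = Negz k)%R by lia.
  by rewrite /= [g ^+ k.+2]expgS invgM mulgVK.
Qed.

Lemma zpowD g r s : zpow g (r + s)%R = zpow g r * zpow g s.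
Proof.
elim: s => [|k IH|k IH]; first by rewrite GRing.addr0 mulg1.
- by rewrite -addn1 PoszD GRing.addrA !zpowS IH mulgA.
- apply: (mulIg g); rewrite -mulgA -!zpowS.
  have -> : (- (k.+1)%:Z + 1 = - k%:Z)%R by lia.
  by rewrite -IH; congr zpow; lia.
Qed.

Lemma zpowN g r : zpow g (- r)%R = (zpow g r)^-1.
Proof.
by apply: (mulIg (zpow g r)); rewrite -zpowD mulVg GRing.addNr.
Qed.

Lemma zpowMn g r (k : nat) : zpow g (r * k%:Z)%R = zpow g r ^+ k.
Proof.
elim: k => [|k IH]; first by rewrite GRing.mulr0.
by rewrite expgSr -IH -zpowD; congr zpow; lia.
Qed.

Lemma zpowC g r s : zpow g r * zpow g s = zpow g s * zpow g r.
Proof. by rewrite -!zpowD GRing.addrC. Qed.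

End IntegerPowers.

Lemma int_max (P : int -> Prop) (b r : int) :
  P r -> (forall q, P q -> (q <= b)%R) -> exists m, is_max P m.
Proof.
move=> Pr leb.
have [k] : exists k : nat, (b - r <= k%:Z)%R by exists `|b - r|%N; lia.
elim: k r Pr => [|k IH] r Pr lek.
  by exists r; split=> // q /leb; lia.
have [[q [Pq ltrq]]|noq] := classic (exists q, P q /\ (r < q)%R).
  by apply: IH Pq _; lia.
exists r; split=> // q Pq; case: (boolP (q <= r)%R) => // nle.
by case: noq; exists q; split=> //; lia.
Qed.

(** * The left order on the group and the powers of Delta *)

Section GarsideGroupTheory.
Variables (M : monoidType) (G : groupType) (iota : M -> G) (Delta : M).
Hypothesis MG : garside_monoid M.
Hypothesis M_nontrivial : exists a : M, a <> 1.
Hypothesis DeltaP : garside_element Delta.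
Hypothesis iotaP : group_of_fractions iota.

Implicit Types (a b c : M) (g h x y z : G) (p q r s : int).

Local Notation "g <=L h" := (gleL iota g h) (at level 70, no associativity).
Local Notation D := (zpow (iota Delta)).

Lemma iota1 : iota 1 = 1.
Proof. by case: iotaP => [[]]. Qed.

Lemma iotaM a b : iota (a * b) = iota a * iota b.
Proof. by case: iotaP => [[_ ->]]. Qed.

Lemma iota_inj : injective iota.
Proof. by case: iotaP. Qed.

Lemma iotaX a k : iota (a ^+ k) = iota a ^+ k.
Proof. by elim: k => [|k IH]; rewrite ?iota1 // !expgS iotaM IH. Qed.

Lemma cancelL a b c : a * b = a * c -> b = c.
Proof. by case: MG => [_ _ [H _] _ _]; apply: H. Qed.

Lemma cancelR a b c : b * a = c * a -> b = c.
Proof. by case: MG => [_ _ [_ H] _ _]; apply: H. Qed.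

(** A nonempty expression of 1 by atoms could be repeated, giving expressions of 1 of every length,
    against the finite norm of 1. *)
Lemma conical a b : a * b = 1 -> a = 1.
Proof.
have [[gen normf] _ _ _ _] := MG.
have [s sA <-] := gen a; have [t tA <-] := gen b.
have [N NP] := normf 1; rewrite -mprod_cat => e.
have st_nil : s ++ t = [::].
  apply/eqP; rewrite -size_eq0 -leqn0 leqNgt; apply/negP => st_gt0.
  have /NP le_N : forall v, v \in flatten (nseq N.+1 (s ++ t)) -> atom v.
    move=> v /flattenP[w]; rewrite mem_nseq => /andP[_ /eqP ->].
    by rewrite mem_cat => /orP[/sA|/tA].
  have : mprod (flatten (nseq N.+1 (s ++ t))) = 1.
    by elim: N.+1 => [|m IH] /=; rewrite ?mprod_nil // mprod_cat e mul1g.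
  move/le_N; rewrite size_flatten /shape map_nseq sumn_nseq leqNgt.
  by rewrite leq_pmull.
by case: s st_nil {sA e} => // _; rewrite mprod_nil.
Qed.

Lemma gle_refl g : g <=L g.
Proof. by exists 1; rewrite iota1 mulg1. Qed.

Lemma gle_trans h g k : g <=L h -> h <=L k -> g <=L k.
Proof. by move=> [a <-] [b <-]; exists (a * b); rewrite iotaM mulgA. Qed.

Lemma gle_mul2l k g h : g <=L h -> k * g <=L k * h.
Proof. by move=> [a <-]; exists a; rewrite mulgA. Qed.

Lemma gle_mulVl k g h : k * g <=L h -> g <=L k^-1 * h.
Proof. by move/(gle_mul2l k^-1); rewrite mulKg. Qed.

Lemma gle_mulVl' k g h : k^-1 * g <=L h -> g <=L k * h.
Proof. by move/(gle_mul2l k); rewrite mulVKg. Qed.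

Lemma gle_anti g h : g <=L h -> h <=L g -> g = h.
Proof.
move=> [a <-] [b e].
suff -> : a = 1 by rewrite iota1 mulg1.
apply: (@conical a b); apply: iota_inj; rewrite iotaM iota1.
by apply: (mulgI g); rewrite mulgA e mulg1.
Qed.

Lemma gle_iota a b : iota a <=L iota b <-> leL a b.
Proof.
split=> [[c e]|[c <-]]; exists c; last by rewrite iotaM.
by apply: iota_inj; rewrite iotaM.
Qed.

Lemma gle_pos c : 1 <=L iota c.
Proof. by exists c; rewrite mul1g. Qed.

Lemma pos_gle g : 1 <=L g -> exists c, iota c = g.
Proof. by case=> c; rewrite mul1g; exists c. Qed.

Lemma gle_mulpos g c : g <=L g * iota c.
Proof. by exists c. Qed.

Lemma simple_generation (P : M -> Prop) :
  P 1 -> (forall a b, leL a Delta -> P b -> P (a * b)) -> forall a, P a.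
Proof.
move=> P1 PM a; have [_ /(_ a)[s sS <-]] := DeltaP.
elim: s sS => [|u s IH] sS; first by rewrite mprod_nil.
rewrite mprod_cons; apply: PM; first by apply: sS; rewrite mem_head.
by apply: IH => v vs; apply: sS; rewrite inE vs orbT.
Qed.

(** For simple a with a b = Delta, balance makes b a left divisor as well, say b c = Delta; then a
    Delta = a b c = Delta c. *)
Lemma DeltaC a : exists b, a * Delta = Delta * b.
Proof.
elim/simple_generation: a => [|a a' [b ab] [b' ab']].
  by exists 1; rewrite mul1g mulg1.
have [leLR _] := DeltaP.
have /leLR[c cD] : leR b Delta by exists a.
by exists (c * b'); rewrite -mulgA ab' !mulgA -{1}cD mulgA ab.
Qed.

Lemma DeltaC' a : exists b, Delta * a = b * Delta.
Proof.
elim/simple_generation: a => [|a a' al [b' ab']].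
  by exists 1; rewrite mul1g mulg1.
have [leLR _] := DeltaP.
have /leLR[c cD] := al.
have /leLR[c' cD'] : leL c Delta by exists a.
by exists (c' * b'); rewrite -mulgA -ab' !mulgA -{1}cD' -[c' * c * a]mulgA cD.
Qed.

(** Conjugation by Delta, in either direction, maps positive elements to positive elements. *)
Lemma gle_mulDr r g h : g <=L h -> g * D r <=L h * D r.
Proof.
have up k x a : x * D k%:Z <=L x * iota a * D k%:Z.
  elim: k x a => [|k IH] x a; first by rewrite /= !mulg1; apply: gle_mulpos.
  rewrite zpow_nat expgS !mulgA -[_ * iota a * _]mulgA -iotaM.
  by have [b ->] := DeltaC a; rewrite iotaM mulgA.
have down k x a : x * D (- k%:Z)%R <=L x * iota a * D (- k%:Z)%R.
  rewrite zpowN zpow_nat; elim: k x a => [|k IH] x a.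
    by rewrite invg1 !mulg1; apply: gle_mulpos.
  rewrite expgSr invgM !mulgA; have [b e] := DeltaC' a.
  have -> : x * iota a / iota Delta = x / iota Delta * iota b.
    apply: (mulIg (iota Delta)); rewrite mulgVK -!mulgA; congr (_ * _).
    by rewrite -iotaM -e iotaM mulKg.
  exact: IH.
case=> c <-.
case: r => [k|k]; first exact: up.
by rewrite NegzE; apply: down.
Qed.

Lemma gle_mulDrV r g h : g * D r <=L h -> g <=L h * D (- r)%R.
Proof. by move/(gle_mulDr (- r)%R); rewrite zpowN mulgK. Qed.

Lemma gle_mulDrV' r g h : g <=L h * D r -> g * D (- r)%R <=L h.
Proof. by move/(gle_mulDr (- r)%R); rewrite zpowN mulgK. Qed.

Lemma gle_D r s : (r <= s)%R -> D r <=L D s.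
Proof.
move=> lers; have -> : s = (r + `|s - r|%N%:Z)%R by lia.
by rewrite zpowD zpow_nat -iotaX; apply: gle_mulpos.
Qed.

(** Otherwise Delta = 1, so that every simple element, and with them all of M, would be trivial. *)
Lemma gle_D_le r s : D r <=L D s -> (r <= s)%R.
Proof.
move=> leD; case: (boolP (r <= s)%R) => // nle.
have /gle_trans/(_ leD) le1 : D (s + 1)%R <=L D r by apply: gle_D; lia.
have := gle_mul2l (D s)^-1 le1; rewrite zpowS mulKg mulVg.
move=> /gle_anti/(_ (gle_pos _)); rewrite -iota1 => /iota_inj Delta1.
case: M_nontrivial => a; elim/simple_generation: a => // a b [c].
by rewrite Delta1 => /conical -> IH; rewrite mul1g.
Qed.

Lemma gle_Dinv r g : D r <=L g -> g^-1 <=L D (- r)%R.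
Proof.
case=> c <-; rewrite invgM -zpowN.
have := gle_mulDr (- r)%R (gle_mul2l (iota c)^-1 (gle_pos c)).
by rewrite mulg1 mulVg mul1g.
Qed.

Lemma gle_Dinv' r g : g <=L D r -> D (- r)%R <=L g^-1.
Proof.
case=> c e; have -> : g^-1 = iota c * D (- r)%R.
  by rewrite zpowN -e invgM mulVKg.
by have := gle_mulDr (- r)%R (gle_pos c); rewrite mul1g.
Qed.

Lemma gle_DM r s g h : D r <=L g -> D s <=L h -> D (r + s)%R <=L g * h.
Proof.
move=> leg leh; rewrite zpowD; apply: gle_trans (gle_mulDr s leg) _.
exact: gle_mul2l.
Qed.

Lemma gleDM r s g h : g <=L D r -> h <=L D s -> g * h <=L D (r + s)%R.
Proof.
move=> leg leh; rewrite zpowD; apply: gle_trans (gle_mulDr s leg).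
exact: gle_mul2l.
Qed.

Lemma gle_DX r g k : D r <=L g -> D (r * k%:Z)%R <=L g ^+ k.
Proof.
move=> leg; elim: k => [|k IH]; first by rewrite GRing.mulr0; apply: gle_refl.
have -> : (r * k.+1%:Z = r + r * k%:Z)%R by lia.
by rewrite expgS; apply: gle_DM.
Qed.

Lemma gleDX r g k : g <=L D r -> g ^+ k <=L D (r * k%:Z)%R.
Proof.
move=> leg; elim: k => [|k IH]; first by rewrite GRing.mulr0; apply: gle_refl.
have -> : (r * k.+1%:Z = r + r * k%:Z)%R by lia.
by rewrite expgS; apply: gleDM.
Qed.

Lemma iota_bounded a : exists k : nat, iota a <=L D k%:Z.
Proof.
elim/simple_generation: a => [|a b lea [k lek]].
  by exists 0; rewrite iota1; apply: gle_refl.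
exists k.+1; have -> : (k.+1%:Z = 1 + k%:Z)%R by lia.
rewrite iotaM; apply: gleDM => //.
by rewrite /= expg1; apply/gle_iota.
Qed.

Lemma bounded g : exists k : nat, D (- k%:Z)%R <=L g /\ g <=L D k%:Z.
Proof.
have [_ _ /(_ g)[a [b ->]]] := iotaP.
have [k lek] := iota_bounded a; have [l lel] := iota_bounded b.
exists (k + l); split.
  have -> : (- (k + l)%:Z = - k%:Z + - l%:Z)%R by lia.
  apply: gle_DM; last exact: gle_Dinv'.
  by apply: gle_trans (gle_pos a); rewrite -[1]/(D 0%R); apply: gle_D; lia.
apply: (@gle_trans (iota a)); last by apply: gle_trans lek _; apply: gle_D; lia.
by exists b; rewrite mulgVK.
Qed.

(** Conjugation by Delta permutes the finitely many simple elements; the product of the orbit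
    lengths is a common period. *)
Lemma Delta_central_power : exists2 e, (0 < e)%N &
  forall a, a * Delta ^+ e = Delta ^+ e * a.
Proof.
have [n [d [d_inj dP]]] := simples_finite Delta MG.
have /fin_all_exists[tau tauP] (i : 'I_n) :
    exists j, d i * Delta = Delta * d j.
  have [leLR _] := DeltaP.
  have /leLR[b bD] : leL (d i) Delta by apply/dP; exists i.
  have [c cD] := DeltaC (d i).
  suff /dP[j cj] : leL c Delta by exists j; rewrite cj.
  have [b' b'D] : leL (d i) Delta by apply/dP; exists i.
  apply/leLR; exists b'.
  by apply: (@cancelL (d i)); rewrite mulgA b'D cD.
have tau_inj : injective tau.
  move=> i j e; apply: d_inj; apply: (@cancelR Delta).
  by rewrite !tauP e.
pose e := (\prod_(i < n) order tau i)%N.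
have tauX k i : d i * Delta ^+ k = Delta ^+ k * d (iter k tau i).
  elim: k i => [|k IH] i; first by rewrite mulg1 mul1g.
  by rewrite expgS mulgA tauP -mulgA IH mulgA iterSr.
exists e; first by apply: prodn_gt0 => i; apply: order_gt0.
elim/simple_generation => [|a b /dP[i <-] IH]; first by rewrite mulg1 mul1g.
rewrite -mulgA IH !mulgA tauX; congr (_ * d _ * _).
rewrite /e (bigD1 i) //= mulnC iterM iter_fix //.
exact: iter_order.
Qed.

Lemma join_exists g h : exists j, [/\ g <=L j, h <=L j &
  forall z, g <=L z -> h <=L z -> j <=L z].
Proof.
have [k [leg _]] := bounded g; have [l [leh _]] := bounded h.
pose m := (k + l)%N.
have pos x i : (i <= m)%N -> D (- i%:Z)%R <=L x -> exists c, iota c = D m%:Z * x.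
  move=> leim lex; apply: pos_gle.
  have -> : 1 = D m%:Z * D (- m%:Z)%R :> G by rewrite -zpowD GRing.addrN.
  by apply: gle_mul2l; apply: gle_trans lex; apply: gle_D; lia.
have [a ag] := pos g k (leq_addr _ _) leg.
have [b bh] := pos h l (leq_addl _ _) leh.
have [_ _ _ [lat _] _] := MG; have [_ [j [aj bj jmin]]] := lat a b.
exists ((D m%:Z)^-1 * iota j); split.
- by apply: gle_mulVl; rewrite -ag; apply/gle_iota.
- by apply: gle_mulVl; rewrite -bh; apply/gle_iota.
move=> z lgz lhz.
have /pos_gle[c cz] : 1 <=L D m%:Z * z.
  apply: gle_trans (gle_pos a) _; rewrite ag; exact: gle_mul2l.
rewrite -[z](mulKg (D m%:Z)); apply: gle_mul2l; rewrite -cz; apply/gle_iota.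
by apply: jmin; apply/gle_iota; rewrite ?ag ?bh cz; apply: gle_mul2l.
Qed.

Definition join g h : G :=
  proj1_sig (constructive_indefinite_description _ (join_exists g h)).

Lemma joinP g h : [/\ g <=L join g h, h <=L join g h &
  forall z, g <=L z -> h <=L z -> join g h <=L z].
Proof. by rewrite /join; case: constructive_indefinite_description. Qed.

Lemma bigjoin_exists (I : eqType) (F : I -> G) (i0 : I) (s : seq I) : i0 \in s ->
  exists j, (forall i, i \in s -> F i <=L j) /\
    (forall z, (forall i, i \in s -> F i <=L z) -> j <=L z).
Proof.
move=> s0; suff [j [j0 js jmin]] : exists j, [/\ F i0 <=L j,
    forall i, i \in s -> F i <=L j &
    forall z, F i0 <=L z -> (forall i, i \in s -> F i <=L z) -> j <=L z].
  by exists j; split=> // z lez; apply: jmin => //; apply: lez.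
elim: s {s0} => [|x s [j [j0 js jmin]]].
  by exists (F i0); split=> //; apply: gle_refl.
have [jl jr jlub] := joinP j (F x).
exists (join j (F x)); split.
- exact: gle_trans jl.
- by move=> i; rewrite inE => /orP[/eqP ->|/js /gle_trans]; last exact.
- move=> z z0 zs; apply: jlub; last by apply: zs; rewrite mem_head.
  by apply: jmin => // i ins; apply: zs; rewrite inE ins orbT.
Qed.

(** The meet taken in M is greatest even among lower bounds z in G: the join of z with 1 is positive
    and still below a and b. *)
Lemma meet_exists a b : exists m, [/\ leL m a, leL m b &
  forall z, z <=L iota a -> z <=L iota b -> z <=L iota m].
Proof.
have [_ _ _ [lat _] _] := MG; have [[m [ma mb mmax]] _] := lat a b.
exists m; split=> // z za zb.
have [zj oj jmin] := joinP z 1.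
have [c cj] := pos_gle oj.
apply: gle_trans zj _; rewrite -cj; apply/gle_iota.
by apply: mmax; apply/gle_iota; rewrite cj; apply: jmin => //; apply: gle_pos.
Qed.

(** * Attained slopes *)

(* [attains g r]: some conjugate of [g] has infimum at least [r]. *)
Definition attains g r : Prop := exists x, x * D r <=L g * x.

Lemma attains_le g r s : (r <= s)%R -> attains g s -> attains g r.
Proof.
move=> lers [x lex]; exists x; apply: gle_trans lex.
by apply: gle_mul2l; apply: gle_D.
Qed.

Lemma attains_DX g r k : attains g r -> attains (g ^+ k) (r * k%:Z)%R.
Proof.
move=> [x lex]; exists x.
have /(gle_DX k) : D r <=L x^-1 * (g * x) by apply: gle_mulVl.
rewrite -[x^-1 * _]/(g ^ x) -conjXg => /(gle_mul2l x).
by rewrite conjgE mulVKg.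
Qed.

Lemma attains_bound g r s : g <=L D s -> attains g r -> (r <= s)%R.
Proof.
move=> ges [x lex]; have [k [kx xk]] := bounded x.
(* Bounding g^n x from both sides gives r n - k <= s n + k; with n > 2 k this excludes r > s. *)
pose n := (2 * k).+1.
have [x' lex'] : attains (g ^+ n) (r * n%:Z)%R.
  by apply: attains_DX; exists x.
have /(gle_DX n) : D r <=L x^-1 * (g * x) by apply: gle_mulVl.
rewrite -[x^-1 * _]/(g ^ x) -conjXg => /(gle_mul2l x).
rewrite conjgE mulVKg => len.
have le1 : D (- k%:Z + r * n%:Z)%R <=L x * D (r * n%:Z)%R.
  by apply: gle_DM => //; apply: gle_refl.
have le2 : g ^+ n * x <=L D (s * n%:Z + k%:Z)%R by apply: gleDM => //; apply: gleDX.
have := gle_D_le (gle_trans le1 (gle_trans len le2)).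
by rewrite /n; nia.
Qed.

(* [y i] is the join of the [g ^- k * x * D (floor ((i + k * p) / q))], [k < q]. *)
Lemma staircase g (q : nat) p x : (0 < q)%N -> x * D p <=L g ^+ q * x ->
  exists y : int -> G, [/\ forall i, y i <=L y (i + 1)%R,
    forall i m, y (i + m * q%:Z)%R = y i * D m &
    forall i k, y i <=L g ^+ k * y (i - k%:Z * p)%R].
Proof.
move=> q_gt0 lex; have q0 : (q%:Z <> 0)%R by lia.
have q0' : (q%:Z != 0)%R by lia.
(* The join of these stands in for the fractional power x D^(i/q): it is monotone in i, gains D when
   i grows by q, and g moves the index by p. *)
pose F i k := (g ^+ k)^-1 * x * D ((i + k%:Z * p)%R %/ q)%Z.
have Fs0 : 0%N \in index_iota 0 q by rewrite mem_index_iota.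
pose yP i := constructive_indefinite_description _ (bigjoin_exists (F i) Fs0).
pose y i := proj1_sig (yP i).
have ley i k : (k < q)%N -> F i k <=L y i.
  rewrite /y; case: (yP i) => j /= [jub _] ltk.
  by apply: jub; rewrite mem_index_iota.
have yle i z : (forall k, (k < q)%N -> F i k <=L z) -> y i <=L z.
  rewrite /y; case: (yP i) => j /= [_ jmin] lez; apply: jmin => k.
  by rewrite mem_index_iota => /lez.
have FD i k m : F (i + m * q%:Z)%R k = F i k * D m.
  rewrite /F -[_ * D m]mulgA -zpowD; congr (_ * D _).
  have -> : (i + m * q%:Z + k%:Z * p = m * q%:Z + (i + k%:Z * p))%R by lia.
  by rewrite divzMDl // GRing.addrC.
have yD i m : y i * D m <=L y (i + m * q%:Z)%R.
  rewrite -[m]GRing.opprK; apply: gle_mulDrV'.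
  rewrite GRing.opprK; apply: yle => k ltk.
  by apply: gle_mulDrV; rewrite -FD; apply: ley.
exists y; split.
- move=> i; apply: yle => k ltk; apply: gle_trans (ley _ _ ltk).
  apply: gle_mul2l; apply: gle_D; apply: lez_pdiv2r; lia.
- move=> i m; apply: gle_anti (yD i m).
  by apply: yle => k ltk; rewrite FD; apply: gle_mulDr; apply: ley.
have step i : y i <=L g * y (i - p)%R.
  apply: yle => k ltk; apply: gle_mulVl'.
  have -> : g^-1 * F i k =
      (g ^+ k.+1)^-1 * x * D ((i - p + k.+1%:Z * p)%R %/ q)%Z.
    rewrite /F expgSr invgM !mulgA; congr (_ * D (_ %/ _)%Z); lia.
  have [ltk1|lek1] := ltnP k.+1 q; first exact: (ley (i - p)%R).
  (* The index wraps around: [F] at q carries g^-q and an extra D^p, and the hypothesis on x puts it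
     below [F] at 0. *)
  have -> : k.+1 = q by apply/eqP; rewrite eqn_leq ltk.
  apply: gle_trans (ley _ 0%N q_gt0); rewrite /F invg1 mul1g GRing.mul0r GRing.addr0.
  rewrite GRing.addrC [(q%:Z * p)%R]GRing.mulrC divzMDl // zpowD mulgA.
  apply: gle_mulDr; rewrite -mulgA.
  by rewrite -[x in X in _ <=L X](mulKg (g ^+ q)); apply: gle_mul2l.
move=> i; elim=> [|k IH].
  by rewrite mul1g GRing.mul0r GRing.subr0; apply: gle_refl.
apply: gle_trans IH _; rewrite expgSr -mulgA; apply: gle_mul2l.
apply: gle_trans (step _) _.
have -> : (i - k%:Z * p - p = i - k.+1%:Z * p)%R by lia.
exact: gle_refl.
Qed.

(** In the staircase of g^n with p = r k and q = k, one factor g^n moves the index by r k, that is,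
    by exactly D^r; so y 0 is a witness. *)
Lemma attains_root g n r k : (0 < k)%N ->
  attains (g ^+ (n * k)) (r * k%:Z)%R -> attains (g ^+ n) r.
Proof.
move=> k_gt0 [x]; rewrite expgnA => /(staircase k_gt0)[y [_ yD yg]].
exists (y 0%R); rewrite -yD.
have := yg (0 + r * k%:Z)%R 1%N; rewrite expg1.
by have -> : (0 + r * k%:Z - 1%N%:Z * (r * k%:Z) = 0)%R by lia.
Qed.

Lemma attains_slope g n m r s : (0 < n)%N -> (0 < m)%N ->
  (s * n%:Z <= r * m%:Z)%R -> attains (g ^+ n) r -> attains (g ^+ m) s.
Proof.
move=> n_gt0 m_gt0 le_s /(attains_DX m); rewrite -expgnA mulnC => at_r.
exact: attains_root n_gt0 (attains_le le_s at_r).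
Qed.

(* If [q] exceeds the number of simple elements, then the chain
   [y 0 <=L y 1 <=L ... <=L y q = y 0 * Delta] of [staircase] repeats some
   [y i = y (i + 1)], and then [m q - n p = 1] makes [y i] a witness for
   [attains (g ^+ n) m], a larger slope with the smaller denominator [n < q]. *)
Lemma attains_denominator N (d : 'I_N -> M) g (q : nat) p :
  enumerates_simples Delta d -> (0 < q)%N -> attains (g ^+ q) p ->
  exists n r, [/\ (0 < n <= N)%N, attains (g ^+ n) r &
    (p * n%:Z <= r * q%:Z)%R].
Proof.
move=> [_ dP]; elim/ltn_ind: q p => q IH p q_gt0 at_p.
have [leqN|ltNq] := leqP q N; first by exists q, p; split; rewrite ?q_gt0.
have N_gt0 : (0 < N)%N.
  have /dP[i _] : leL 1 Delta by exists Delta; rewrite mul1g.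
  exact: leq_ltn_trans (leq0n i) (ltn_ord i).
have q_gt1 : (1 < q)%N by apply: leq_ltn_trans ltNq.
have [/coprimezP[[u w] /= uw]|ncop] := boolP (coprimez p q); last first.
  have k_gt0 : (0 < gcdn `|p| q)%N by rewrite gcdn_gt0 q_gt0 orbT.
  have /dvdnP[q1 qE] := dvdn_gcdr `|p| q.
  have : (gcdz p q %| p)%Z by apply: dvdz_gcdl.
  rewrite /gcdz absz_nat => /dvdzP[p1 pE].
  have k_neq1 : gcdn `|p| q != 1%N by move: ncop; rewrite /coprimez /gcdz absz_nat.
  move: (gcdn _ _) k_gt0 qE pE k_neq1 => k k_gt0 qE pE k_neq1.
  have q1_gt0 : (0 < q1)%N by nia.
  have at1 : attains (g ^+ q1) p1.
    by apply: attains_root k_gt0 _; rewrite -qE -pE.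
  have [|n [r [n_gt0 at_r le_r]]] := IH q1 _ p1 q1_gt0 at1; first by nia.
  exists n, r; split=> //; rewrite pE qE PoszM; nia.
have [x lex] := at_p.
have [y [yS yD yg]] := staircase q_gt0 lex.
have [i yi] : exists i, y i = y (i + 1)%R.
  have ley i k : y i <=L y (i + k%:Z)%R.
    elim: k => [|k le_k]; first by rewrite GRing.addr0; apply: gle_refl.
    apply: gle_trans le_k _; rewrite -addn1 PoszD GRing.addrA; exact: yS.
  have simple (i : 'I_q) : exists j, y 0%R * iota (d j) = y (Posz i).
    have [c cE] := ley 0%R i; have [c' cE'] := ley (Posz i) (q - i)%N.
    have /dP[j dj] : leL c Delta.
      exists c'; apply: iota_inj; apply: (mulgI (y 0%R)).
      rewrite iotaM mulgA cE GRing.add0r cE' -[iota Delta]expg1.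
      rewrite -[_ ^+ 1]/(D 1%N) -yD; congr y; have := ltn_ord i; lia.
    by exists j; rewrite dj cE GRing.add0r.
  have /fin_all_exists[f fP] := simple.
  have /injectivePn[i [j ne_ij fij]] : ~~ injectiveb f.
    apply/negP => /injectiveP/leq_card; rewrite !card_ord leqNgt.
    by rewrite ltNq.
  have yij : y (Posz i) = y (Posz j) by rewrite -!fP fij.
  wlog ltij : i j ne_ij yij {fij} / (i < j)%N.
    move=> H; case: (ltngtP i j) => [|ltji|/val_inj e].
    - exact: H.
    - by apply: H ltji => //; rewrite eq_sym.
    - by rewrite e eqxx in ne_ij.
  exists (Posz i); apply: gle_anti (yS _) _; rewrite yij.
  have -> : (j%:Z = i%:Z + 1 + (j - i.+1)%N%:Z)%R by lia.
  exact: ley.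
(* The Bezout coefficient -u is reduced modulo q, so that the new denominator n is smaller than
   q. *)
pose t := ((- u) %/ q)%Z.
have tE := divz_eq (- u)%R q; rewrite -/t in tE.
have : (0 <= ((- u)%R %% q)%Z)%R by apply: modz_ge0; lia.
have : (((- u)%R %% q)%Z < q%:Z)%R by apply: ltz_pmod; lia.
move: tE; case: ((- u)%R %% q)%Z => // n tE lt_nq _.
have [m mn] : exists m : int, (m * q%:Z - n%:Z * p = 1)%R.
  exists (w - t * p)%R; rewrite -uw.
  have -> : u = (- (t * q%:Z + n%:Z))%R by lia.
  lia.
have n_gt0 : (0 < n)%N.
  rewrite lt0n; apply/eqP => n0; rewrite n0 GRing.mul0r GRing.subr0 in mn.
  by have [m_le|m_ge] : (m <= 0)%R \/ (1 <= m)%R by [lia]; nia.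
have at_m : attains (g ^+ n) m.
  exists (y i); rewrite {2}yi -yD.
  have -> : (i + 1 = i + m * q%:Z - n%:Z * p)%R by lia.
  exact: yg.
have [|n' [r [n'P at_r le_r]]] := IH n _ m n_gt0 at_m; first by lia.
exists n', r; split=> //.
have : (n%:Z * (p * n'%:Z) <= n%:Z * (r * q%:Z))%R by nia.
by nia.
Qed.

(* Among the conjugates of [h], [h] has the greatest infimum. *)
Definition infmax h : Prop := forall x r, x * D r <=L h * x -> D r <=L h.

Lemma infmax_periodic : exists2 m, (0 < m)%N & forall h,
  (forall n, (0 < n <= m)%N -> infmax (h ^+ n)) ->
  forall n, (0 < n)%N -> infmax (h ^+ n).
Proof.
have [N [d dP]] := simples_finite Delta MG.
(* Every denominator up to N divides N!, so all attained slopes compare with those of the single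
   power h^m. *)
exists N`! => [|h hm n n_gt0 x s les]; first exact: fact_gt0.
set m := N`! in hm *; have m_gt0 : (0 < m)%N by exact: fact_gt0.
have [k0 [leh geh]] := bounded h.
have [A [at_A maxA]] : exists A, is_max (attains (h ^+ m)) A.
  apply: (@int_max _ (k0%:Z * m%:Z)%R (- k0%:Z * m%:Z)%R) => [|q].
    by apply: attains_DX; exists 1; rewrite mul1g mulg1.
  by apply: attains_bound; apply: gleDX.
have slope k r : (0 < k)%N -> attains (h ^+ k) r -> (r * m%:Z <= A * k%:Z)%R.
  move=> k_gt0 /(attains_denominator dP k_gt0)[n' [r' [n'P at_r' ler]]].
  have /dvdnP[c mE] : (n' %| m)%N by apply: dvdn_fact.
  have : (r' * c%:Z <= A)%R.
    by apply: maxA; rewrite mE mulnC expgnA; apply: attains_DX.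
  by rewrite mE PoszM; nia.
have Ah : D A <=L h ^+ m.
  by case: at_A => z; apply: hm; rewrite m_gt0 leqnn.
(* The remainder is taken in 1..m instead of 0..m-1, so that the hypothesis covers h^t. *)
pose k := (n.-1 %/ m)%N; pose t := (n.-1 %% m).+1.
have nE : (n = m * k + t)%N.
  by rewrite /t addnS mulnC -divn_eq prednK.
have tP : (0 < t <= m)%N by rewrite /= ltn_mod.
have at_s : (s * m%:Z <= A * n%:Z)%R by apply: slope => //; exists x.
have [z lez] : attains (h ^+ t) (s - A * k%:Z)%R.
  apply: attains_slope m_gt0 _ _ at_A => //.
  by rewrite nE PoszD PoszM in at_s; nia.
have -> : s = (A * k%:Z + (s - A * k%:Z))%R by lia.
rewrite nE expgnDr expgnA; apply: gle_DM; first exact: gle_DX.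
exact: hm lez.
Qed.

(** * Finiteness of divisor chains *)

Lemma norm_bound a : exists N, forall u : seq M,
  (forall b, b \in u -> b <> 1) -> leL (mprod u) a -> (size u <= N)%N.
Proof.
have [[gen /(_ a)[N NP]] _ _ _ _] := MG.
exists N => u u_neq1 [c uc]; have [tc tcA tcE] := gen c.
suff [t [tA tE leu]] : exists t : seq M, [/\ forall b, b \in t -> atom b,
    mprod t = mprod u & (size u <= size t)%N].
  apply: leq_trans leu _; apply: leq_trans (NP (t ++ tc) _ _).
  - by rewrite size_cat leq_addr.
  - by move=> b; rewrite mem_cat => /orP[/tA|/tcA].
  - by rewrite mprod_cat tE tcE.
elim: u u_neq1 {uc} => [|b u IH] u_neq1; first by exists [::].
have [|t [tA tE leu]] := IH.
  by move=> b' b'u; apply: u_neq1; rewrite inE b'u orbT.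
have [tb tbA tbE] := gen b; exists (tb ++ t); split.
- by move=> b'; rewrite mem_cat => /orP[/tbA|/tA].
- by rewrite mprod_cat mprod_cons tbE tE.
rewrite size_cat /= -add1n leq_add // lt0n size_eq0; apply/eqP => tb0.
by apply: (u_neq1 b); rewrite ?mem_head // -tbE tb0 mprod_nil.
Qed.

(** If no iterate were fixed, each round would contribute a nontrivial factor to a divisor of a,
    against [norm_bound]. *)
Lemma increasing_stops (phi : G -> G) a :
  (forall z, z <=L phi z) -> (forall z, z <=L iota a -> phi z <=L iota a) ->
  exists i, phi (iter i phi 1) = iter i phi 1.
Proof.
move=> incr ub; apply: NNPP => nostop.
have chain i : exists s : seq M, [/\ size s = i, forall b, b \in s -> b <> 1 &
    iota (mprod s) = iter i phi 1].
  elim: i => [|i [s [szs s_neq1 sE]]].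
    by exists [::]; split=> //; rewrite mprod_nil iota1.
  have [b bE] := incr (iter i phi 1).
  exists (rcons s b); split; first by rewrite size_rcons szs.
  - move=> b'; rewrite mem_rcons inE => /orP[/eqP -> b1|/s_neq1 //].
    by apply: nostop; exists i; rewrite -bE b1 iota1 mulg1.
  - by rewrite -cats1 mprod_cat iotaM sE mprod_cons mprod_nil mulg1 bE.
have le_a i : iter i phi 1 <=L iota a.
  by elim: i => [|i IH]; [apply: gle_pos | apply: ub].
have [N NP] := norm_bound a; have [s [szs s_neq1 sE]] := chain N.+1.
have := NP s s_neq1; rewrite szs ltnn => H.
by apply: notF; apply: H; apply/gle_iota; rewrite sE.
Qed.

(** * Conjugators of bounded length *)

Section BoundedSearch.
Variables (e N : nat) (d : 'I_N -> M).
Hypothesis e_gt0 : (0 < e)%N.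
Hypothesis EC : forall a, a * Delta ^+ e = Delta ^+ e * a.
Hypothesis dP : enumerates_simples (Delta ^+ e) d.

Lemma central g r : g * D (e%:Z * r)%R = D (e%:Z * r)%R * g.
Proof.
have cE a : commute (iota Delta ^+ e) (iota a).
  by rewrite /commute -iotaX -!iotaM EC.
have cg : commute g (iota Delta ^+ e).
  have [_ _ /(_ g)[a [b ->]]] := iotaP.
  by apply: commute_sym; apply: commuteM => //; apply: commuteV.
case: r => k; last rewrite NegzE GRing.mulrN zpowN.
  by rewrite zpowMn zpow_nat; apply: commuteX.
by apply: commuteV; rewrite zpowMn zpow_nat; apply: commuteX.
Qed.

(** A central factor does not affect conjugation, so conjugators may be taken in M. *)
Lemma central_positive x : exists k : nat, 1 <=L D (e%:Z * k%:Z)%R * x.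
Proof.
have [k [kx _]] := bounded x; exists k.
have -> : 1 = D (e%:Z * k%:Z)%R * D (- (e%:Z * k%:Z))%R :> G.
  by rewrite -zpowD GRing.addrN.
apply: gle_mul2l; apply: gle_trans kx; apply: gle_D.
by nia.
Qed.

(* The least [x] above [1] with [x * D r <=L g * x] is the join of the elements
   [g ^- k * D (r * k)]; conjugation by it does not increase the supremum. *)
Lemma attains_keeping_sup g r s : g <=L D s -> attains g r ->
  exists x, x * D r <=L g * x /\ g * x <=L x * D s.
Proof.
move=> ges at_r; have lers := attains_bound ges at_r.
have [x lex] := at_r; have [k /pos_gle[a aE]] := central_positive x.
have lea : iota a * D r <=L g * iota a.
  by rewrite aE mulgA [g * _]central -!mulgA; apply: gle_mul2l.
pose phi z := join z (g^-1 * z * D r).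
have [||i stop] := @increasing_stops phi a.
- by move=> z; have [] := joinP z (g^-1 * z * D r).
- move=> z lez; have [_ _] := joinP z (g^-1 * z * D r); apply=> //.
  apply: gle_trans (gle_mulDr r (gle_mul2l g^-1 lez)) _.
  by rewrite -mulgA -[X in _ <=L X](mulKg g); apply: gle_mul2l.
exists (iter i phi 1); split.
  have [_ le2 _] := joinP (iter i phi 1) (g^-1 * iter i phi 1 * D r).
  by rewrite -/(phi _) stop -mulgA in le2; apply: gle_mulVl'.
(* Every iterate z satisfies g z <= z D^s: the two arguments of the join are treated separately, the
   second one using r <= s. *)
elim: {stop} i => [|i IH]; first by rewrite mulg1 mul1g.
set z := iter i phi 1 in IH *; have [le1 le2 lub] := joinP z (g^-1 * z * D r).
rewrite iterS -/z -/(phi z) in le1 le2 lub *.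
rewrite -[X in _ <=L X](mulVKg g); apply: gle_mul2l.
apply: (lub (g^-1 * (phi z * D s))).
  apply: gle_mulVl; apply: gle_trans IH _; exact: gle_mulDr.
rewrite -mulgA; apply: gle_mul2l; apply: (@gle_trans (z * D s)).
  by apply: gle_mul2l; apply: gle_D.
exact: gle_mulDr.
Qed.

Definition value (w : seq 'I_N) : M := mprod [seq d i | i <- w].

Lemma value_cons i w : value (i :: w) = d i * value w.
Proof. exact: mprod_cons. Qed.

Lemma word_below_power c k : iota c <=L D (e * k)%N ->
  exists w : k.-tuple 'I_N, value w = c.
Proof.
elim: k c => [|k IH] c lec.
  exists [tuple]; rewrite /value mprod_nil; apply: iota_inj; rewrite iota1.
  by apply: gle_anti (gle_pos c) _; rewrite muln0 in lec.
have [m [mc mE mmax]] := meet_exists c (Delta ^+ e).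
have [_ /(_ m)[/(_ mE)[i im] _]] := dP.
have [c' cE] := mc.
have [|w wc'] := IH c'; last by exists [tuple of i :: w]; rewrite value_cons im wc'.
(* With E = Delta^e, the element c E^-k lies below both c and E, hence below their meet m; it need
   not be positive. Cancelling m leaves c' <= E^k. *)
have : iota c * D (- (e * k)%N%:Z)%R <=L iota m.
  apply: mmax.
    rewrite -[X in _ <=L X]mulg1 -[1]/(D 0%R); apply: gle_mul2l.
    by apply: gle_D; lia.
  apply: gle_mulDrV'; rewrite iotaX -zpow_nat -zpowD.
  by have -> : (e%:Z + (e * k)%N%:Z = (e * k.+1)%N%:Z)%R by lia.
move/gle_mulDrV; rewrite GRing.opprK -cE iotaM => /(gle_mul2l (iota m)^-1).
by rewrite !mulKg.
Qed.

(** The claim amounts to g^-1 m D^r <= m. Since m is a meet, it suffices to bound the left side by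
    a, where the infimum of g ^ a enters, and by Delta^e, which commutes with D^r. *)
Lemma meet_conjugation_inf r g a m : D r <=L g -> D r <=L g ^ iota a ->
  leL m a -> leL m (Delta ^+ e) ->
  (forall z, z <=L iota a -> z <=L iota (Delta ^+ e) -> z <=L iota m) ->
  D r <=L g ^ iota m.
Proof.
move=> leg lega ma mE mmax.
rewrite conjgE; apply: gle_mulVl; apply: gle_mulVl'.
apply: mmax.
  rewrite -[X in _ <=L X](mulKg g); apply: gle_mul2l.
  apply: (@gle_trans (iota a * D r)).
    by apply: gle_mulDr; apply/gle_iota.
  by have := gle_mul2l (iota a) lega; rewrite conjgE mulVKg.
rewrite -[X in _ <=L X](mulKg g); apply: gle_mul2l.
apply: (@gle_trans (iota (Delta ^+ e) * D r)).
  by apply: gle_mulDr; apply/gle_iota.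
rewrite iotaX -zpow_nat zpowC; exact: gle_mulDr.
Qed.

Lemma meet_conjugation_sup r g a m : g <=L D r -> g ^ iota a <=L D r ->
  leL m a -> leL m (Delta ^+ e) ->
  (forall z, z <=L iota a -> z <=L iota (Delta ^+ e) -> z <=L iota m) ->
  g ^ iota m <=L D r.
Proof.
move=> /gle_Dinv' leg; move=> /gle_Dinv'; rewrite -conjVg => lega ma mE mmax.
have /gle_Dinv := meet_conjugation_inf leg lega ma mE mmax.
by rewrite conjVg invgK GRing.opprK.
Qed.

Variable l : nat.

Definition in_interval g : Prop :=
  D (- (e * l)%N%:Z)%R <=L g /\ g <=L D (e * l)%N.

(** Shifted by Delta^(e l), the interval consists of products of 2 l letters, so this finite type
    covers it, possibly with repetitions. *)
Definition interval_element (t : (2 * l).-tuple 'I_N) : G :=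
  iota (value t) * D (- (e * l)%N%:Z)%R.

Lemma interval_elementP g : in_interval g -> exists t, interval_element t = g.
Proof.
move=> [leg geg].
have [c cE] : exists c, iota c = g * D (e * l)%N.
  apply: pos_gle; have := gle_mulDr (e * l)%N leg.
  by rewrite zpowN mulVg.
have [t tc] : exists t : (2 * l).-tuple 'I_N, value t = c.
  apply: word_below_power; rewrite cE.
  have -> : Posz (e * (2 * l)) = ((e * l)%N%:Z + (e * l)%N%:Z)%R by lia.
  by rewrite zpowD; apply: gle_mulDr.
by exists t; rewrite /interval_element tc cE zpowN mulgK.
Qed.

Definition simple_conj : rel ((2 * l).-tuple 'I_N) := fun t t' =>
  [exists i, interval_element t * iota (d i) == iota (d i) * interval_element t'].

Lemma connect_conj k a t t' : iota a <=L D (e * k)%N ->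
  in_interval (interval_element t) -> in_interval (interval_element t') ->
  interval_element t' = interval_element t ^ iota a -> connect simple_conj t t'.
Proof.
elim: k a t => [|k IH] a t lea int_t int_t' conj_t.
  have a1 : a = 1.
    apply: iota_inj; rewrite iota1; apply: gle_anti (gle_pos a).
    by rewrite muln0 in lea.
  (* Different tuples may denote the same element; the letter for 1 provides the edge between
     them. *)
  have [i i1] : exists i, d i = 1.
    by case: dP => _ dE; apply/dE; exists (Delta ^+ e); rewrite mul1g.
  apply: connect1; apply/existsP; exists i.
  by rewrite conj_t a1 i1 iota1 conjg1 mulg1 mul1g.
have [m [ma mE mmax]] := meet_exists a (Delta ^+ e).
have [_ /(_ m)[/(_ mE)[i im] _]] := dP.
have [a' aE] := ma.
have int_m : in_interval (interval_element t ^ iota m).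
  by split; [apply: meet_conjugation_inf ma mE mmax => // |
    apply: meet_conjugation_sup ma mE mmax => //]; rewrite -?conj_t;
    case: int_t; case: int_t'.
have [u uE] := interval_elementP int_m.
apply: (@connect_trans _ _ u).
  apply: connect1; apply/existsP; exists i.
  by rewrite uE im conjgE mulVKg.
apply: (IH a') => //; last by rewrite uE -conjgM -iotaM aE.
  have : iota a * D (- (e * k)%N%:Z)%R <=L iota m.
    apply: mmax.
      rewrite -[X in _ <=L X]mulg1 -[1]/(D 0%R); apply: gle_mul2l.
      by apply: gle_D; lia.
    apply: gle_mulDrV'; rewrite iotaX -zpow_nat -zpowD.
    by have -> : (e%:Z + (e * k)%N%:Z = (e * k.+1)%N%:Z)%R by lia.
  move/gle_mulDrV; rewrite GRing.opprK -aE iotaM => /(gle_mul2l (iota m)^-1).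
  by rewrite !mulKg.
by rewrite uE.
Qed.

Lemma conj_bounded g x : in_interval g -> in_interval (g ^ x) ->
  exists w, (size w <= N ^ (2 * l))%N /\ g ^ x = g ^ iota (value w).
Proof.
move=> int_g int_gx; have [k /pos_gle[a aE]] := central_positive x.
have ga : g ^ x = g ^ iota a.
  rewrite aE conjgM; congr (_ ^ x); apply/esym/conjg_fixP.
  by apply/commgP; apply: central.
have [t tE] := interval_elementP int_g.
have [t' t'E] := interval_elementP int_gx.
have [k' lea] := iota_bounded a.
have /connectP[p pP lastp] : connect simple_conj t t'.
  apply: (@connect_conj k' a); rewrite ?tE ?t'E //.
  by apply: gle_trans lea _; apply: gle_D; nia.
(* A path without repetitions has fewer steps than there are tuples, namely N ^ (2 l). *)
case/shortenP: pP lastp => q qP q_uniq _ lastq.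
have : (size q <= N ^ (2 * l))%N.
  have := max_card (mem (t :: q)).
  by rewrite (card_uniqP q_uniq) card_tuple card_ord; apply: ltnW.
rewrite -t'E -tE lastq.
elim: q {q_uniq lastq tE} t qP (N ^ _)%N => [|u q IH] t /=.
  by exists [::]; rewrite /value mprod_nil iota1 conjg1.
move=> /andP[/existsP[i /eqP tu] qP] [//|b] ltb.
have [w [lew wE]] := IH u qP b ltb.
exists (i :: w); split=> //.
by rewrite value_cons iotaM conjgM wE [interval_element t ^ _]conjgE tu mulKg.
Qed.

(** Exponents up to r are settled by D^r <= g, and those above s are excluded by [attains_bound]. In
    between, [attains_keeping_sup] yields a conjugate inside the interval, which [conj_bounded]
    reaches by a short word. *)
Lemma infmax_bounded g r s :
  (- (e * l)%N%:Z <= r)%R -> (s <= (e * l)%N%:Z)%R -> D r <=L g -> g <=L D s ->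
  (forall w, (size w <= N ^ (2 * l))%N -> forall q, (r <= q <= s)%R ->
    iota (value w) * D q <=L g * iota (value w) -> D q <=L g) ->
  infmax g.
Proof.
move=> ler les leg geg hw x q lex.
have at_q : attains g q by exists x.
have leqs := attains_bound geg at_q.
have [leqr|ltrq] : (q <= r)%R \/ (r <= q)%R by lia.
  by apply: gle_trans leg; apply: gle_D.
have [y [ley gey]] := attains_keeping_sup geg at_q.
have [||w [lew wE]] := @conj_bounded g y.
- by split; [apply: gle_trans leg|apply: gle_trans geg _]; apply: gle_D.
- split; first by apply: (@gle_trans (D q));
    [apply: gle_D; lia | apply: gle_mulVl].
  apply: (@gle_trans (D s)); last exact: gle_D.
  by rewrite conjgE -[D s](mulKg y); apply: gle_mul2l.
apply: (hw w lew); first by rewrite ltrq.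
have -> : g * iota (value w) = iota (value w) * g ^ y.
  by rewrite wE conjgE mulVKg.
by apply: gle_mul2l; apply: gle_mulVl.
Qed.

End BoundedSearch.

(** * Super summit sets in terms of maximal infima *)

Lemma inf_exists g : exists r, is_inf iota Delta g r.
Proof.
have [k [kg gk]] := bounded g.
apply: (@int_max _ k%:Z _ kg) => q qg.
exact: gle_D_le (gle_trans qg gk).
Qed.

Lemma gle_inv_D g r : D r <=L g^-1 <-> g <=L D (- r)%R.
Proof.
by split=> [/gle_Dinv|/gle_Dinv']; rewrite ?invgK ?GRing.opprK.
Qed.

Lemma is_min_opp (P Q : int -> Prop) r : (forall q, P q <-> Q (- q)%R) ->
  is_min P r <-> is_max Q (- r)%R.
Proof.
move=> PQ; split=> [[Pr minr]|[Qr maxr]]; split; try exact/PQ; move=> q Pq.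
  have := minr (- q)%R; rewrite PQ GRing.opprK => /(_ Pq); lia.
by have := maxr (- q)%R ((PQ q).1 Pq); lia.
Qed.

Lemma is_sup_inv g r : is_sup iota Delta g r <-> is_inf iota Delta g^-1 (- r)%R.
Proof. by apply: is_min_opp => q; rewrite gle_inv_D GRing.opprK. Qed.

Lemma conjugate_inv g h : conjugate g h <-> conjugate g^-1 h^-1.
Proof.
split=> -[x e]; exists x; first by rewrite e conjVg.
by rewrite -[h]invgK e conjVg invgK.
Qed.

Lemma is_sup_s_inv g r :
  is_sup_s iota Delta g r <-> is_inf_s iota Delta g^-1 (- r)%R.
Proof.
apply: is_min_opp => q; split=> -[h gh supq]; exists h^-1.
- exact: (conjugate_inv g h).1.
- exact: (is_sup_inv h q).1.
- by apply: (conjugate_inv g _).2; rewrite invgK.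
- by apply: (is_sup_inv _ q).2; rewrite invgK.
Qed.

Lemma infmaxP g h : conjugate g h ->
  (exists2 r, is_inf iota Delta h r & is_inf_s iota Delta g r) <-> infmax h.
Proof.
move=> [x hE]; split=> [[r [Dr maxr] [_ maxs]] y q leq|hmax].
  have [q' [Dq' maxq']] := inf_exists (h ^ y).
  have leqq' : (q <= q')%R by apply: maxq'; apply: gle_mulVl.
  have leq'r : (q' <= r)%R.
    by apply: maxs; exists (h ^ y) => //; exists (x * y); rewrite hE conjgM.
  by apply: gle_trans Dr; apply: gle_D; lia.
have [r [Dr maxr]] := inf_exists h; exists r => //; split.
  by exists h => //; exists x.
move=> q [h' [x' h'E] [Dq _]]; apply: maxr; apply: (hmax (x^-1 * x')).
have -> : h * (x^-1 * x') = x^-1 * x' * h'.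
  by rewrite hE h'E !conjgE !mulgA !(mulgK, mulgVK).
exact: gle_mul2l.
Qed.

Lemma super_summitP g h : super_summit iota Delta g h <->
  [/\ conjugate g h, infmax h & infmax h^-1].
Proof.
have supE : (exists2 r, is_sup iota Delta h r & is_sup_s iota Delta g r) <->
    (exists2 r, is_inf iota Delta h^-1 r & is_inf_s iota Delta g^-1 r).
  split=> -[r r1 r2]; exists (- r)%R.
  - exact: (is_sup_inv h r).1.
  - exact: (is_sup_s_inv g r).1.
  - by apply: (is_sup_inv h _).2; rewrite GRing.opprK.
  - by apply: (is_sup_s_inv g _).2; rewrite GRing.opprK.
split=> [[gh /(infmaxP gh) ih /supE]|[gh ih ih']].
  by move=> /(infmaxP ((conjugate_inv g h).1 gh)) ih'; split.
split=> //; first exact/infmaxP.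
by apply/supE; apply/infmaxP => //; apply: (conjugate_inv g h).1.
Qed.

(** Powers of conjugate elements are conjugate by the same element, so a single conjugacy question
    serves all n. *)
Lemma stable_super_summitP g h : stable_super_summit iota Delta g h <->
  conjugate g h /\
  forall n, (0 < n)%N -> infmax (h ^+ n) /\ infmax (h ^- n).
Proof.
split=> [[/super_summitP[gh _ _] ss]|[gh ih]].
  by split=> // n /ss/super_summitP[].
have ss n : (1 <= n)%N -> super_summit iota Delta (g ^+ n) (h ^+ n).
  move=> n_gt0; have [ih1 ih2] := ih n n_gt0; apply/super_summitP; split=> //.
  by have [x ->] := gh; exists x; rewrite conjXg.
by split=> //; have := ss 1%N isT; rewrite !expg1.
Qed.

(** * Reduction to positive elements and bounded words *)

Section Criterion.
Variables (e N : nat) (d : 'I_N -> M).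
Hypothesis e_gt0 : (0 < e)%N.
Hypothesis EC : forall a, a * Delta ^+ e = Delta ^+ e * a.
Hypothesis dP : enumerates_simples (Delta ^+ e) d.

Let centralg := central EC.

(** A central power of Delta shifts the infima of all conjugates by the same amount. *)
Lemma infmax_central g r : infmax (g * D (e%:Z * r)%R) <-> infmax g.
Proof.
suff shift g' r' : infmax g' -> infmax (g' * D (e%:Z * r')%R).
  split=> [/(shift _ (- r)%R)|]; last exact: shift.
  by rewrite GRing.mulrN zpowN mulgK.
move=> ig x q lex; have -> : q = (q - e%:Z * r' + e%:Z * r')%R by lia.
rewrite zpowD; apply: gle_mulDr; apply: (ig x).
rewrite zpowD mulgA; apply: gle_mulDrV'.
by rewrite -mulgA centralg mulgA.
Qed.

Variables (P Q : M) (a b : nat).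
Let g := iota P * D (- (e%:Z * a%:Z))%R.
Let h := iota Q * D (- (e%:Z * b%:Z))%R.

Lemma conjugateE x : h = g ^ x <->
  iota P * x * iota ((Delta ^+ e) ^+ b) = x * iota Q * iota ((Delta ^+ e) ^+ a).
Proof.
have ED k : iota ((Delta ^+ e) ^+ k) = D (e%:Z * k%:Z)%R.
  by rewrite zpowMn zpow_nat -!iotaX.
rewrite !ED; transitivity (x * h = g * x).
  by split=> [-> |eq]; rewrite conjgE ?mulVKg // -eq mulKg.
rewrite /g /h -!GRing.mulrN; set A := D (e%:Z * a%:Z)%R; set B := D (e%:Z * b%:Z)%R.
have gE : iota P * D (e%:Z * - a%:Z)%R * x = iota P * x * A^-1.
  by rewrite -mulgA -centralg GRing.mulrN zpowN mulgA.
have hE : x * (iota Q * D (e%:Z * - b%:Z)%R) = x * iota Q * B^-1.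
  by rewrite GRing.mulrN zpowN mulgA.
rewrite gE hE; split=> eq.
  apply: (mulIg B^-1); rewrite mulgK -mulgA -zpowN -zpowD.
  rewrite GRing.addrC zpowD mulgA zpowN eq mulgVK //.
apply: (mulIg A); rewrite mulgVK.
rewrite -[x * _ / B * A]mulgA -zpowN -[D _ * A]zpowD GRing.addrC zpowD zpowN mulgA.
by rewrite -eq mulgK.
Qed.

Lemma infmaxXE n : (infmax (h ^+ n) <-> infmax (iota Q ^+ n)) /\
  (infmax (h ^- n) <-> infmax (iota Q ^- n)).
Proof.
have hnE : h ^+ n = iota Q ^+ n * D (e%:Z * (- b%:Z * n%:Z))%R.
  rewrite /h expgMn; last by rewrite /commute -GRing.mulrN centralg.
  by rewrite -zpowMn; congr (_ * D _); lia.
split; first by rewrite hnE; apply: infmax_central.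
rewrite hnE invgM -zpowN -GRing.mulrN -centralg; exact: infmax_central.
Qed.

Lemma infmax_posP c n j : infmax (iota Q ^+ n) ->
  leL (c * Delta ^+ j) (Q ^+ n * c) -> leL (Delta ^+ j) (Q ^+ n).
Proof.
move=> iq /gle_iota; rewrite !iotaM !iotaX => lex.
by apply/gle_iota; rewrite !iotaX; apply: (iq (iota c) j).
Qed.

Lemma infmax_negP c n j : infmax (iota Q ^- n) ->
  leL (Q ^+ n * c) (c * Delta ^+ j) -> leL (Q ^+ n) (Delta ^+ j).
Proof.
move=> iq /gle_iota; rewrite !iotaM !iotaX => lex.
apply/gle_iota; rewrite !iotaX -[_ ^+ j]/(D j) -[Posz j]GRing.opprK.
apply/gle_inv_D; apply: (iq (iota c)); apply: gle_mulDrV'.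
by rewrite -mulgA; apply: gle_mulVl.
Qed.

Lemma conjugate_boundedP l : (a <= l)%N -> (b <= l)%N ->
  iota P <=L D (e * l)%N -> iota Q <=L D (e * l)%N ->
  conjugate g h <-> exists w : seq 'I_N, (size w <= N ^ (2 * l))%N /\
    P * value d w * (Delta ^+ e) ^+ b = value d w * Q * (Delta ^+ e) ^+ a.
Proof.
move=> leal lebl leP leQ.
have int c k : (k <= l)%N -> iota c <=L D (e * l)%N ->
    in_interval e l (iota c * D (- (e%:Z * k%:Z))%R).
  move=> lekl lec; split.
    have lek : D (- (e * l)%N%:Z)%R <=L D (- (e%:Z * k%:Z))%R.
      by apply: gle_D; nia.
    apply: gle_trans lek _; rewrite -[X in X <=L _]mul1g.
    by apply: gle_mulDr; apply: gle_pos.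
  apply: gle_trans lec; rewrite -[X in _ <=L X]mulg1; apply: gle_mul2l.
  by rewrite -[1]/(D 0%R); apply: gle_D; nia.
split=> [[x hE]|[w [_ wE]]]; last first.
  by exists (iota (value d w)); apply/conjugateE; rewrite -!iotaM wE.
have [||w [lew wE]] := conj_bounded e_gt0 EC dP (l := l) (g := g) (x := x).
- exact: int.
- by rewrite -hE; apply: int.
exists w; split=> //; rewrite wE in hE; move/conjugateE: hE.
by rewrite -!iotaM => /iota_inj.
Qed.

Lemma infmax_pos_bounded l n : iota Q ^+ n <=L D (e * l)%N ->
  (forall (w : seq 'I_N) j, (size w <= N ^ (2 * l))%N -> (j <= e * l)%N ->
    leL (value d w * Delta ^+ j) (Q ^+ n * value d w) ->
    leL (Delta ^+ j) (Q ^+ n)) ->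
  infmax (iota Q ^+ n).
Proof.
move=> leQ hw.
apply: (infmax_bounded e_gt0 EC dP (l := l) (r := 0%R) (s := (e * l)%N)) => //.
- by nia.
- by rewrite -iotaX; apply: gle_pos.
move=> w lew [j|//] /andP[_ lej] lewj.
rewrite -iotaX zpow_nat -iotaX; apply/gle_iota; apply: (hw w) => //.
by apply/gle_iota; rewrite !iotaM !iotaX.
Qed.

(** The element Q^-n lies between Delta^-(e l) and 1, so only exponents -j matter; moving Q^n and
    Delta^j across turns the comparison into divisibility in M. *)
Lemma infmax_neg_bounded l n : iota Q ^+ n <=L D (e * l)%N ->
  (forall (w : seq 'I_N) j, (size w <= N ^ (2 * l))%N -> (j <= e * l)%N ->
    leL (Q ^+ n * value d w) (value d w * Delta ^+ j) ->
    leL (Q ^+ n) (Delta ^+ j)) ->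
  infmax (iota Q ^- n).
Proof.
move=> leQ hw.
apply: (infmax_bounded e_gt0 EC dP (l := l) (r := (- (e * l)%N%:Z)%R)
  (s := 0%R)) => //.
- by apply/gle_inv_D; rewrite GRing.opprK.
- have /gle_Dinv : D 0%R <=L iota Q ^+ n by rewrite -iotaX; apply: gle_pos.
  by rewrite GRing.oppr0.
move=> w lew q /andP[geq leq0] lewq.
have [j qE] : exists j : nat, q = (- j%:Z)%R by exists `|q|%N; lia.
rewrite qE in geq lewq *; apply/gle_inv_D; rewrite GRing.opprK.
rewrite zpow_nat -!iotaX; apply/gle_iota; apply: (hw w) => //; first by lia.
apply/gle_iota; rewrite !iotaM !iotaX -[iota Delta ^+ j]/(D j).
rewrite -[Posz j]GRing.opprK; apply: gle_mulDrV.
rewrite -mulgA -[X in _ <=L X](mulVKg (iota Q ^+ n)).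
exact: gle_mul2l.
Qed.

End Criterion.

(** * Divisibility of positive words *)

Section WordProblem.
Variables (E : M) (N : nat) (d : 'I_N -> M).
Hypothesis EC : forall a, a * E = E * a.
Hypothesis dP : enumerates_simples E d.

Lemma leL_trans b a c : leL a b -> leL b c -> leL a c.
Proof. by move=> [x <-] [y <-]; exists (x * y); rewrite mulgA. Qed.

Lemma leL_mul2l a b c : leL (a * b) (a * c) <-> leL b c.
Proof.
split=> -[x e]; exists x; last by rewrite -mulgA e.
by apply: (@cancelL a); rewrite mulgA.
Qed.

Lemma leL_anti a b : leL a b -> leL b a -> a = b.
Proof.
by move=> /gle_iota ab /gle_iota ba; apply: iota_inj; apply: gle_anti.
Qed.

Lemma residual_exists a b : exists c, is_join (@leL M) a b (a * c).
Proof.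
have [_ _ _ [lat _] _] := MG; have [_ [j jP]] := lat a b.
by have [[c cE] _ _] := jP; exists c; rewrite cE.
Qed.

Definition residual a b : M :=
  proj1_sig (constructive_indefinite_description _ (residual_exists a b)).

Lemma residualP a b : is_join (@leL M) a b (a * residual a b).
Proof. by rewrite /residual; case: constructive_indefinite_description. Qed.

Lemma residual_unique a b c : is_join (@leL M) a b (a * c) -> residual a b = c.
Proof.
have [la lb lub] := residualP a b; move=> [la' lb' lub'].
by apply: (@cancelL a); apply: leL_anti; [apply: lub | apply: lub'].
Qed.

Lemma residual_join a b : a * residual a b = b * residual b a.
Proof.
have [la lb lub] := residualP a b; have [lb' la' lub'] := residualP b a.
by apply: leL_anti; [apply: lub | apply: lub'].
Qed.

Lemma residual_eq1 a b : residual a b = 1 <-> leL b a.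
Proof.
split=> [r1|leba]; last first.
  apply: residual_unique; rewrite mulg1; split=> //.
  by exists 1; rewrite mulg1.
by have [_ + _] := residualP a b; rewrite r1 mulg1.
Qed.

Lemma residual1 a : residual a 1 = 1.
Proof. by apply/residual_eq1; exists a; rewrite mul1g. Qed.

Lemma residual1l a : residual 1 a = a.
Proof.
apply: residual_unique; rewrite mul1g; split=> //; first by exists a; rewrite mul1g.
by exists 1; rewrite mulg1.
Qed.

(** The join of a with b c is formed in two stages: with b first, which leaves [residual b a] to be
    joined with c. This rule lets a word be read letter by letter. *)
Lemma residualM a b c :
  residual a (b * c) = residual a b * residual (residual b a) c.
Proof.
apply: residual_unique; rewrite mulgA residual_join -mulgA.
have [la lb lub] := residualP a b.
have [lr lc lubr] := residualP (residual b a) c.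
split.
- by apply: leL_trans la _; rewrite residual_join leL_mul2l.
- exact/leL_mul2l.
move=> x ax bcx; have [y xE] : leL b x.
  by apply: leL_trans bcx; exists c.
rewrite -xE in ax bcx *; apply/leL_mul2l; move/leL_mul2l: bcx => cy.
apply: lubr => //; apply/(leL_mul2l b); rewrite -residual_join.
by apply: lub => //; exists y.
Qed.

Lemma residualMl a b c : residual (a * b) c = residual b (residual a c).
Proof.
apply: residual_unique; rewrite -mulgA.
have [la lc lub] := residualP a c.
have [lb lr lubr] := residualP b (residual a c).
split; first exact/leL_mul2l.
- by apply: leL_trans lc _; apply/leL_mul2l.
move=> x [y <-] cx; rewrite -mulgA; apply/leL_mul2l; apply: lubr.
  by exists y.
apply/(leL_mul2l a); apply: lub; last by rewrite mulgA.
by exists (b * y).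
Qed.

(** From a (residual a b) c = E and centrality, (residual a b) c a = E. Hence the letters form a
    finite set closed under residuals. *)
Lemma residual_simple a b : leL a E -> leL b E -> leL (residual a b) E.
Proof.
move=> aE bE; have [_ _ /(_ E aE bE)[c cE]] := residualP a b.
exists (c * a); apply: (@cancelL a).
by rewrite !mulgA cE EC.
Qed.

(** Plain numbers serve as letters so that programs can handle them. Indices from N on denote 1,
    hence truncating an index at N keeps its meaning. *)
Definition letter (i : nat) : M := nth 1 [seq d j | j <- enum 'I_N] i.

Definition letters (s : seq nat) : M := mprod [seq letter i | i <- s].

Lemma letters_cons i (s : seq nat) : letters (i :: s) = letter i * letters s.
Proof. exact: mprod_cons. Qed.

Lemma letters_cat (s t : seq nat) : letters (s ++ t) = letters s * letters t.
Proof. by rewrite /letters map_cat mprod_cat. Qed.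

Lemma letter_ord (i : 'I_N) : letter i = d i.
Proof. by rewrite /letter (nth_map i) ?size_enum_ord // nth_ord_enum. Qed.

Lemma letters_ord (w : seq 'I_N) :
  letters [seq nat_of_ord i | i <- w] = value d w.
Proof.
rewrite /letters /value -map_comp; congr mprod.
by apply: eq_map => i; apply: letter_ord.
Qed.

Lemma letter_minn i : letter (minn i N) = letter i.
Proof.
case: leqP => // /ltnW lt_Ni.
by rewrite /letter !nth_default // size_map size_enum_ord // ltnW.
Qed.

Lemma letter_simple i : leL (letter i) E.
Proof.
have [lt_iN|le_Ni] := ltnP i N.
  by case: dP => _ dE; apply/dE; exists (Ordinal lt_iN); rewrite -letter_ord.
have -> : letter i = 1 by rewrite /letter nth_default // size_map size_enum_ord.
by exists E; rewrite mul1g.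
Qed.

Lemma simple_letter a : leL a E -> exists i, letter i = a.
Proof.
by case: dP => _ dE /dE[i <-]; exists i; rewrite letter_ord.
Qed.

Lemma residual_letter_exists i j :
  exists k, letter k = residual (letter i) (letter j).
Proof.
by apply: simple_letter; apply: residual_simple; apply: letter_simple.
Qed.

Definition residual_letter i j : nat := proj1_sig
  (constructive_indefinite_description _
    (residual_letter_exists (minn i N) (minn j N))).

Lemma residual_letterP i j :
  letter (residual_letter i j) = residual (letter i) (letter j).
Proof.
rewrite /residual_letter; case: constructive_indefinite_description => k /= ->.
by rewrite !letter_minn.
Qed.

(* One run of a Mealy machine on [s]: the state [head 0 acc] is the residual of
   the letter [i] by the part of [s] already read, and [behead acc] is the
   reversed output. *)
Definition residual_pass (s : seq nat) (i : nat) : seq nat :=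
  rev (behead (foldl (fun acc j => residual_letter j (head 0 acc)
    :: residual_letter (head 0 acc) j :: behead acc) [:: i] s)).

Definition residual_word (s t : seq nat) : seq nat := foldl residual_pass s t.

Definition word_le (s t : seq nat) : bool :=
  all (fun i => letter (minn i N) == 1) (residual_word s t).

Lemma residual_passP (s : seq nat) i :
  letters (residual_pass s i) = residual (letter i) (letters s).
Proof.
(* Generalised to any accumulator: the output so far times the residual of the state by the unread
   letters is invariant. *)
rewrite /residual_pass -[RHS]mul1g.
have <- : letters (rev (behead [:: i])) = 1 by rewrite /letters mprod_nil.
rewrite -{3}[i]/(head 0 [:: i]).
elim: s [:: i] => [|j s IH] acc /=.
  by rewrite {3}/letters mprod_nil residual1 mulg1.
rewrite IH /= rev_cons -cats1 letters_cat residual_letterP -mulgA; congr (_ * _).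
by rewrite !letters_cons residual_letterP residualM /letters mprod_nil mulg1.
Qed.

Lemma residual_wordP (s t : seq nat) :
  letters (residual_word s t) = residual (letters t) (letters s).
Proof.
elim: t s => [|i t IH] s /=; first by rewrite {2}/letters mprod_nil residual1l.
by rewrite [LHS]IH residual_passP letters_cons residualMl.
Qed.

(** By [conical], the residual word has value 1 only if each of its letters does. *)
Lemma word_leP (s t : seq nat) : word_le s t <-> leL (letters s) (letters t).
Proof.
rewrite -residual_eq1 -residual_wordP /word_le.
elim: (residual_word s t) => [|i u IH] /=; first by rewrite /letters mprod_nil.
rewrite letters_cons letter_minn; split=> [/andP[/eqP -> /IH ->]|iu].
  by rewrite mulg1.
have i1 := conical iu; rewrite i1 eqxx /=; apply/IH.
by rewrite i1 mul1g in iu.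
Qed.

End WordProblem.

(** * The decision procedure and its correctness *)

Section Decision.
Variables (n : nat) (d : 'I_n -> M) (e N : nat) (dE : 'I_N -> M) (m : nat).
Hypothesis dP : enumerates_simples Delta d.
Hypothesis e_gt0 : (0 < e)%N.
Hypothesis EC : forall a, a * Delta ^+ e = Delta ^+ e * a.
Hypothesis dEP : enumerates_simples (Delta ^+ e) dE.
Hypothesis m_gt0 : (0 < m)%N.
Hypothesis mP : forall h, (forall k, (0 < k <= m)%N -> infmax (h ^+ k)) ->
  forall k, (0 < k)%N -> infmax (h ^+ k).

Local Notation letter := (letter dE).
Local Notation letters := (letters dE).
Local Notation word_le := (word_le EC dEP).

Lemma Delta_leL_power : leL Delta (Delta ^+ e).
Proof. by exists (Delta ^+ e.-1); rewrite -expgS prednK. Qed.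

(* The inverse of [d i] is represented by the complement of [d i] in the central
   element [Delta ^+ e], which differs from it by the factor [Delta ^+ e]. *)
Lemma signed_letter_exists (l : 'I_n * bool) : exists k,
  if l.2 then d l.1 * letter k = Delta ^+ e else letter k = d l.1.
Proof.
case: l => i b /=.
have : leL (d i) (Delta ^+ e).
  apply: leL_trans Delta_leL_power.
  by case: dP => _ dD; apply/dD; exists i.
case: b => [[c cE]|/(simple_letter dEP) //].
have /(simple_letter dEP)[k kc] : leL c (Delta ^+ e).
  by exists (d i); apply: (@cancelL (d i)); rewrite mulgA cE EC.
by exists k; rewrite kc.
Qed.

Definition signed_letter (c : nat) : nat :=
  if insub c./2 is Some i then
    proj1_sig (constructive_indefinite_description _
      (signed_letter_exists (i, odd c)))
  else 0%N.

Lemma signed_letterP (i : 'I_n) (b : bool) :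
  let c := signed_letter (i.*2 + b) in
  if b then d i * letter c = Delta ^+ e else letter c = d i.
Proof.
rewrite /signed_letter.
have -> : ((i.*2 + b)./2 = i)%N by rewrite addnC half_bit_double.
have -> : odd (i.*2 + b) = b by rewrite oddD odd_double oddb.
rewrite valK; case: constructive_indefinite_description => k /=.
by case: b.
Qed.

Lemma simple_letters_exist : exists k : nat * nat * nat,
  [/\ letter k.1.1 = 1, letter k.1.2 = Delta & letter k.2 = Delta ^+ e].
Proof.
have [|k1 k1P] := simple_letter dEP (a := 1).
  by exists (Delta ^+ e); rewrite mul1g.
have [kD kDP] := simple_letter dEP Delta_leL_power.
have [|kE kEP] := simple_letter dEP (a := Delta ^+ e).
  by exists 1; rewrite mulg1.
by exists (k1, kD, kE).
Qed.

Definition codes (u : word n) : seq nat :=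
  [seq (nat_of_ord l.1).*2 + nat_of_bool l.2 | l : 'I_n * bool <- u]%N.

Definition negative (u : word n) : nat := count (fun l => l.2) u.

Lemma word_valueE (u : word n) : word_value iota d u =
  iota (letters (map signed_letter (codes u)))
    * D (- (e%:Z * (negative u)%:Z))%R.
Proof.
rewrite /word_value; elim: u => [|[i b] u IH].
  by rewrite big_nil /letters mprod_nil iota1 GRing.mulr0 mulg1.
rewrite big_cons {}IH /= letters_cons iotaM; have := signed_letterP i b.
case: b => /= [cE|->]; last by rewrite add0n !mulgA.
have -> : (iota (d i))^-1 = iota (letter (signed_letter (i.*2 + 1)))
    * D (e%:Z * - 1)%R.
  apply: (mulgI (iota (d i))); rewrite mulgV mulgA -iotaM cE iotaX.
  rewrite -[iota Delta ^+ e]/(D e) -zpowD.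
  by have -> : (e%:Z + e%:Z * -1 = 0)%R by lia.
rewrite -mulgA [D _ * _]mulgA -(central EC) -!mulgA -zpowD.
by congr (_ * (_ * D _)); lia.
Qed.

Lemma letters_bounded (s : seq nat) : iota (letters s) <=L D (e * size s)%N.
Proof.
elim: s => [|i s IH].
  by rewrite /letters mprod_nil iota1 muln0; apply: gle_refl.
rewrite letters_cons iotaM.
have -> : Posz (e * size (i :: s)) = (e%:Z + (e * size s)%N%:Z)%R.
  by rewrite /=; lia.
apply: gleDM => //; rewrite zpow_nat -iotaX; apply/gle_iota.
exact: (letter_simple dEP).
Qed.

Lemma letters_const (k : nat) (s : seq nat) :
  letters [seq k | _ <- s] = letter k ^+ size s.
Proof.
by elim: s => [|i s IH]; rewrite /= ?letters_cons ?IH ?expgS // /letters mprod_nil.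
Qed.

Definition power_word (s : seq nat) k : seq nat := iter k (cat s) [::].

Lemma letters_power (s : seq nat) k : letters (power_word s k) = letters s ^+ k.
Proof.
elim: k => [|k IH]; first by rewrite /letters mprod_nil.
by rewrite /= letters_cat IH expgS.
Qed.

Lemma size_power_word (s : seq nat) k : size (power_word s k) = (k * size s)%N.
Proof. by elim: k => [|k IH] //=; rewrite size_cat IH mulSn. Qed.

Variables (k1 kD kE : nat).
Hypothesis k1P : letter k1 = 1.
Hypothesis kDP : letter kD = Delta.
Hypothesis kEP : letter kE = Delta ^+ e.

(** Odd codes are formal inverses, each costing a factor Delta^e; relettering a word in this way
    spells its central denominator without counting. *)
Definition denominator_letter (c : nat) : nat := if odd c then kE else k1.

Lemma denominatorP (u : word n) :
  letters (map denominator_letter (codes u)) = (Delta ^+ e) ^+ negative u.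
Proof.
elim: u => [|[i b] u IH]; first by rewrite /letters mprod_nil.
rewrite /= letters_cons IH /denominator_letter oddD odd_double oddb /=.
by case: b; rewrite ?kEP ?k1P ?mul1g // expgS.
Qed.

Definition conj_test (U V x : seq nat) : bool :=
  let L := map signed_letter U ++ (x ++ map denominator_letter V) in
  let R := x ++ (map signed_letter V ++ map denominator_letter U) in
  word_le L R && word_le R L.

(** The two cases refute maximality of the infimum for Q^k and for Q^-k, with x as conjugator. Only
    the length of y matters: it is an exponent of Delta in unary. *)
Definition violation k (V x y : seq nat) : bool :=
  let Q := power_word (map signed_letter V) k in
  let Y := [seq kD | _ <- y] in
  (word_le (x ++ Y) (Q ++ x) && ~~ word_le Y Q)
  || (word_le (Q ++ x) (x ++ Y) && ~~ word_le Q Y).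

(* Exceeds the code of every list of length at most [N ^ (2 * l) + e * l] with
   entries at most [N]. *)
Definition search_bound (U V : seq nat) : nat :=
  let l := (m * (size U + size V))%N in
  2 ^ (N.+1 * (N ^ (2 * l) + e * l)).

Definition decision (U V : seq nat) : bool :=
  let B := search_bound U V in
  has (fun x : nat => conj_test U V (CodeSeq.decode x)) (seq.iota 0 B)
  && all (fun k => ~~ has (fun y : nat => has (fun x : nat =>
        violation k V (CodeSeq.decode x) (CodeSeq.decode y))
      (seq.iota 0 B)) (seq.iota 0 B)) (index_iota 1 m.+1).

Lemma decisionP (u v : word n) : decision (codes u) (codes v) <->
  stable_super_summit iota Delta (word_value iota d u) (word_value iota d v).
Proof.
pose U := codes u; pose V := codes v.
pose P := letters (map signed_letter U); pose Q := letters (map signed_letter V).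
(* One l for all tests: each letter lies below Delta^e, so P and all Q^k with k <= m lie below
   Delta^(e l), and l also bounds both denominators. *)
pose l := (m * (size U + size V))%N.
have leU : (size U <= l)%N by rewrite /l; nia.
have leV k : (k <= m)%N -> (k * size V <= l)%N by rewrite /l; nia.
have leP : iota P <=L D (e * l)%N.
  apply: gle_trans (letters_bounded _) _; apply: gle_D.
  by rewrite size_map; nia.
have leQ k : (k <= m)%N -> iota Q ^+ k <=L D (e * l)%N.
  move=> lek; rewrite -iotaX -letters_power.
  apply: gle_trans (letters_bounded _) _; apply: gle_D.
  by rewrite size_power_word size_map; have := leV k lek; nia.
have leQ1 : iota Q <=L D (e * l)%N by rewrite -[iota Q]expg1; apply: leQ.
have lea : (negative u <= l)%N.
  by apply: leq_trans (count_size _ _) _; rewrite size_map in leU.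
have leb : (negative v <= l)%N.
  apply: leq_trans (count_size _ _) _.
  by have := leV 1%N m_gt0; rewrite mul1n size_map.
have in_range (s : seq nat) : all (fun j => j <= N)%N s ->
    (size s <= N ^ (2 * l) + e * l)%N ->
    CodeSeq.code s \in seq.iota 0 (search_bound U V).
  move=> s_le sz_s; rewrite mem_iota /= add0n.
  apply: leq_trans (code_lt_bound s_le) _.
  by rewrite leq_exp2l // leq_mul2l sz_s orbT.
have word_range (w : seq 'I_N) : (size w <= N ^ (2 * l))%N ->
    CodeSeq.code [seq nat_of_ord i | i <- w] \in seq.iota 0 (search_bound U V).
  move=> lew; apply: in_range; last by rewrite size_map (leq_trans lew) ?leq_addr.
  by apply/allP => _ /mapP[i _ ->]; apply: ltnW.
rewrite !word_valueE stable_super_summitP.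
rewrite (conjugate_boundedP e_gt0 EC dEP lea leb leP leQ1).
have conjE (x : seq nat) : conj_test U V x <->
    P * letters x * (Delta ^+ e) ^+ negative v
      = letters x * Q * (Delta ^+ e) ^+ negative u.
  rewrite /conj_test -!denominatorP -/U -/V.
  split=> [/andP[/word_leP + /word_leP]|eq].
    by rewrite !letters_cat !mulgA; apply: leL_anti.
  by apply/andP; split; apply/word_leP; rewrite !letters_cat !mulgA eq;
    exists 1; rewrite mulg1.
have violationE k (x y : seq nat) : violation k V x y <->
    (leL (letters x * Delta ^+ size y) (Q ^+ k * letters x) /\
       ~ leL (Delta ^+ size y) (Q ^+ k)) \/
    (leL (Q ^+ k * letters x) (letters x * Delta ^+ size y) /\
       ~ leL (Q ^+ k) (Delta ^+ size y)).
  have <- : letters [seq kD | _ <- y] = Delta ^+ size y.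
    by rewrite letters_const kDP.
  rewrite /violation -letters_power -!letters_cat.
  split=> [/orP[]/andP[/word_leP le1 /negP nle]|].
  - by left; split=> // /word_leP.
  - by right; split=> // /word_leP.
  by move=> [] [/word_leP le1 nle]; apply/orP; [left|right]; apply/andP; split=> //;
    apply/negP => /word_leP.
rewrite /decision.
split=> [/andP[/hasP[cx _ /conjE eq] /allP noviol]|[[w [lew wE]] ih]].
  split.
    apply/(conjugate_boundedP e_gt0 EC dEP lea leb leP leQ1).
    (* The list found need not obey the length bound: any solution is a conjugator. *)
    exists (iota (letters (CodeSeq.decode cx))); apply/conjugateE => //.
    by rewrite -!iotaM eq.
  have qmax k : (0 < k <= m)%N ->
      infmax (iota Q ^+ k) /\ infmax (iota Q ^- k).
    move=> /andP[k_gt0 lek].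
    have nov (w : seq 'I_N) j : (size w <= N ^ (2 * l))%N -> (j <= e * l)%N ->
        ~ violation k V [seq nat_of_ord i | i <- w] (nseq j 0%N).
      move=> lew lej viol.
      have /noviol/hasPn : k \in index_iota 1 m.+1.
        by rewrite mem_index_iota k_gt0.
      have yr : CodeSeq.code (nseq j 0%N) \in seq.iota 0 (search_bound U V).
        apply: in_range; last by rewrite size_nseq (leq_trans lej) ?leq_addl.
        by apply/allP => i; rewrite mem_nseq => /andP[_ /eqP ->].
      move=> /(_ _ yr)/hasPn/(_ _ (word_range w lew)).
      by rewrite !CodeSeq.codeK viol.
    split.
      apply: (infmax_pos_bounded e_gt0 EC dEP (leQ k lek)) => w j lew lej le1.
      apply: NNPP => nle; apply: (nov w j lew lej); apply/violationE; left.
      by rewrite size_nseq letters_ord.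
    apply: (infmax_neg_bounded e_gt0 EC dEP (leQ k lek)) => w j lew lej le1.
    apply: NNPP => nle; apply: (nov w j lew lej); apply/violationE; right.
    by rewrite size_nseq letters_ord.
  move=> k k_gt0; have [E1 E2] := infmaxXE e_gt0 EC Q (negative v) k.
  split; [apply/E1|apply/E2].
    by apply: mP => // k' /qmax[].
  (* Negative powers are the positive powers of the inverse of Q, to which the same m applies. *)
  by rewrite -expVgn; apply: mP => // k' /qmax[_]; rewrite expVgn.
apply/andP; split.
  apply/hasP; exists (CodeSeq.code [seq nat_of_ord i | i <- w]).
    exact: word_range.
  by rewrite CodeSeq.codeK; apply/conjE; rewrite letters_ord.
apply/allP => k; rewrite mem_index_iota => /andP[k_gt0 _].
apply/hasPn => cy _; apply/hasPn => cx _; apply/negP => /violationE.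
have [E1 E2] := infmaxXE e_gt0 EC Q (negative v) k.
have [/E1 i1 /E2 i2] := ih k k_gt0.
by move=> [] [le1]; apply; [apply: infmax_posP i1 le1|apply: infmax_negP i2 le1].
Qed.


Lemma computable_word_le k A B : lcomputable k A -> lcomputable k B ->
  computable k (fun w => word_le (A w) (B w)).
Proof.
move=> cA cB.
(* Since [residual_letter] truncates its arguments, it unfolds to a finite table. *)
have cR : computable2 (residual_letter EC dEP).
  exact: (computable_table2 N (fun i j => proj1_sig
    (constructive_indefinite_description _ (residual_letter_exists EC dEP i j)))).
have c0 : lcomputable 2 (fun w => CodeSeq.decode (nth 0%N w 0)).
  by apply: lcomputable_decode; apply: computable_nth.
have c1 : computable 2 (fun w => nth 0%N w 1) by apply: computable_nth.
have ch := computable_lhead c0.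
have cS : lcomputable 2 (fun w => (fun acc j =>
    residual_letter EC dEP j (head 0%N acc)
      :: residual_letter EC dEP (head 0%N acc) j :: behead acc)
    (CodeSeq.decode (nth 0%N w 0)) (nth 0%N w 1)).
  apply: lcomputable_cons; first exact: (computable_comp2 cR).
  apply: lcomputable_cons; first exact: (computable_comp2 cR).
  exact: lcomputable_behead.
have cpass : lcomputable 2 (fun w =>
    residual_pass EC dEP (CodeSeq.decode (nth 0%N w 0)) (nth 0%N w 1)).
  apply: lcomputable_rev; apply: lcomputable_behead.
  apply: (lcomputable_foldl cS _ c0).
  by apply: lcomputable_cons => //; apply: computable_const.
apply: computable_all; last exact: (lcomputable_foldl cpass).
exact: (computable_table1 N (fun i => letter i == 1)).
Qed.

(** Codes from 2 n on all get the default 0, so a table up to 2 n suffices. *)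
Lemma computable_signed_letter : computable1 signed_letter.
Proof.
apply: eq_computable (computable_table1 n.*2 signed_letter) => w _.
case: leqP => // lt_n; rewrite /signed_letter !insubF //.
  by apply/negbTE; rewrite -leqNgt geq_half_double ltnW.
by rewrite half_double ltnn.
Qed.

Lemma computable_denominator_letter : computable1 denominator_letter.
Proof.
apply: computable_if; [|exact: computable_const|exact: computable_const].
(* Parity is obtained by iterating the flip z -> 1 - z. *)
have cs : computable 2 (fun w => 1 - nth 0%N w 0)%N.
  apply: (computable_comp2 computable_sub); first exact: computable_const.
  exact: computable_nth.
apply: eq_computable (computable_iter (computable_const 1 0%N) cs
  (@computable_nth 1 0 isT)) => w _ /=.
by elim: (nth 0%N w 0) => //= k ->; case: (odd k).
Qed.

(** The exponent is not an input: there is one program for each j, and only j <= m occur. *)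
Lemma lcomputable_power_word k j A : lcomputable k A ->
  lcomputable k (fun w => power_word (A w) j).
Proof.
move=> cA; elim: j => [|j IH]; first exact: computable_const.
exact: lcomputable_cat.
Qed.

Lemma computable_conj_test k U V X :
  lcomputable k U -> lcomputable k V -> lcomputable k X ->
  computable k (fun w => conj_test (U w) (V w) (X w)).
Proof.
move=> cU cV cX.
have cs A : lcomputable k A -> lcomputable k (fun w => map signed_letter (A w)).
  exact: lcomputable_map computable_signed_letter.
have cd A : lcomputable k A -> lcomputable k (fun w => map denominator_letter (A w)).
  exact: lcomputable_map computable_denominator_letter.
have cL : lcomputable k (fun w => map signed_letter (U w) ++
    (X w ++ map denominator_letter (V w))).
  by apply: lcomputable_cat; [apply: cs | apply: lcomputable_cat => //; apply: cd].
have cR : lcomputable k (fun w => X w ++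
    (map signed_letter (V w) ++ map denominator_letter (U w))).
  by apply: lcomputable_cat => //; apply: lcomputable_cat; [apply: cs | apply: cd].
by apply: computable_and; apply: computable_word_le.
Qed.

Lemma computable_violation k j V X Y :
  lcomputable k V -> lcomputable k X -> lcomputable k Y ->
  computable k (fun w => violation j (V w) (X w) (Y w)).
Proof.
move=> cV cX cY.
have cQ : lcomputable k (fun w => power_word (map signed_letter (V w)) j).
  apply/lcomputable_power_word/lcomputable_map => //.
  exact: computable_signed_letter.
have cD : lcomputable k (fun w => [seq kD | _ <- Y w]).
  by apply: lcomputable_map => //; apply: computable_const.
have cl := lcomputable_cat cX cD; have cr := lcomputable_cat cQ cX.
by apply: computable_or; apply: computable_and; try apply: computable_not;
  apply: computable_word_le.
Qed.

Lemma computable_search_bound k U V : lcomputable k U -> lcomputable k V ->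
  computable k (fun w => search_bound (U w) (V w)).
Proof.
move=> cU cV.
have cc (c : nat) : computable k (fun=> c) by apply: computable_const.
have cadd A B := @computable_comp2 k addn A B computable_add.
have cmul A B := @computable_comp2 k muln A B computable_mul.
have cexp A B := @computable_comp2 k expn A B computable_exp.
have cl : computable k (fun w => m * (size (U w) + size (V w)))%N.
  by apply: (cmul) => //; apply: (cadd); apply: computable_size.
apply: (cexp) => //; apply: (cmul) => //; apply: (cadd); last exact: (cmul).
by apply: (cexp) => //; apply: (cmul).
Qed.

Lemma computable_decision :
  computable 2 (fun w => decision (CodeSeq.decode (nth 0%N w 0))
                                  (CodeSeq.decode (nth 0%N w 1))).
Proof.
have cv k i : (i < k)%N -> lcomputable k (fun w => CodeSeq.decode (nth 0%N w i)).
  by move=> lt_ik; apply: lcomputable_decode; apply: computable_nth.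
apply: computable_and.
  exact: (computable_has (computable_search_bound (cv 2%N 0%N isT) (cv 2%N 1%N isT))
    (computable_conj_test (cv 3%N 1%N isT) (cv 3%N 2%N isT) (cv 3%N 0%N isT))).
(* As m is fixed, this is a finite conjunction of programs and needs no loop. In the nested search,
   x and y come before the two inputs. *)
elim: (index_iota 1 m.+1) => [|j s IH]; first exact: computable_const.
apply: computable_and => //; apply: computable_not.
apply: (computable_has (computable_search_bound (cv 2%N 0%N isT) (cv 2%N 1%N isT))
  (c := fun w => has (fun x : nat => violation j (CodeSeq.decode (nth 0%N w 2))
    (CodeSeq.decode x) (CodeSeq.decode (nth 0%N w 0)))
    (seq.iota 0 (search_bound (CodeSeq.decode (nth 0%N w 1))
                              (CodeSeq.decode (nth 0%N w 2)))))).
exact: (computable_has (computable_search_bound (cv 3%N 1%N isT) (cv 3%N 2%N isT))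
  (computable_violation j (cv 4%N 3%N isT) (cv 4%N 0%N isT) (cv 4%N 1%N isT))).
Qed.

End Decision.
End GarsideGroupTheory.

Theorem corollary6p2 (M : monoidType) (G : groupType) (iota : M -> G)
    (Delta : M) (n : nat) (d : 'I_n -> M) :
  garside_monoid M ->
  (exists a : M, a <> 1%g) ->
  garside_element Delta ->
  group_of_fractions iota ->
  enumerates_simples Delta d ->
  exists p : partrec 2,
    forall u v : word n,
      exists b : bool,
        evaluates p [tuple word_code u; word_code v] b /\
        (b <-> stable_super_summit iota Delta
                 (word_value iota d u) (word_value iota d v)).
Proof.
move=> MG neM DeltaP iotaP dP.
have [e e_gt0 EC] := Delta_central_power MG DeltaP.
have [N [dE dEP]] := simples_finite (Delta ^+ e) MG.
have [m m_gt0 mP] := infmax_periodic MG neM DeltaP iotaP.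
have [[[k1 kD] kE] [k1P kDP kEP]] := simple_letters_exist e_gt0 dEP.
have [p pP] := computable_decision MG m dP e_gt0 EC dEP k1 kD kE.
exists p => u v; have := pP [tuple word_code u; word_code v].
rewrite /= !CodeSeq.codeK; eexists; split; first by eassumption.
exact: (decisionP MG neM DeltaP iotaP dP e_gt0 EC dEP m_gt0 mP k1P kDP kEP).
Qed.
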